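(* Let $\lambda,\mu$ be partitions with at most $n$ parts. Then \[ g_{\lambda/\mu}(\mathbf x;\boldsymbol\alpha,\boldsymbol\beta)=\sum_{\substack{\rho,\nu\\ \mu\subseteq\rho\subseteq\nu\subseteq\lambda}}c_{\lambda,\nu}(\boldsymbol\alpha,\boldsymbol\beta)\,s_{\nu/\rho}(\mathbf x)\,c'_{\rho,\mu}(\boldsymbol\alpha,\boldsymbol\beta), \] the sum over partitions $\rho,\nu$ with at most $n$ parts, where $c_{\lambda,\nu}(\boldsymbol\alpha,\boldsymbol\beta)=\det(h_{\lambda_i-\nu_j-i+j}[-A_{\lambda_i-1}+B_{i-1}])_{i,j=1}^n$ and $c'_{\rho,\mu}(\boldsymbol\alpha,\boldsymbol\beta)=\det(h_{\rho_i-\mu_j-i+j}[A_{\mu_j}-B_{j-1}])_{i,j=1}^n$.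
   Context: $A_k=\alpha_1+\dots+\alpha_k$, $B_k=\beta_1+\dots+\beta_k$ for $k\ge1$, $A_k=B_k=0$ for $k\le0$. For a formal $\mathbb Z$-linear combination $Z=\sum_uc_uu$ of parameters, $\sum_{m\ge0}h_m[Z]t^m=\prod_u(1-ut)^{-c_u}$, $h_m[Z]=0$ for $m<0$. $s_{\nu/\rho}$ is the skew Schur function. $g_{\lambda/\mu}(\mathbf x;\boldsymbol\alpha,\boldsymbol\beta)$ is the sum of $\mathrm{wt}(T)$ over all (left-)marked reverse plane partitions $T$ of shape $\lambda/\mu$ (and is $0$ if $\mu\not\subseteq\lambda$): fillings by positive integers weakly increasing along rows and columns, where each $T(i,j)$ with $(i,j+1)$ in the shape and $T(i,j)=T(i,j+1)$ may be marked; $\mathrm{wt}(T)=\prod_{(i,j)}w(i,j)$ with $w=-\alpha_j$ if marked, $w=\beta_{i-1}$ if unmarked, $(i-1,j)$ in the shape and $T(i,j)=T(i-1,j)$, and $w=x_{T(i,j)}$ otherwise. *)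

(* Defs.v *)
From HB Require Import structures.
From mathcomp Require Import all_boot all_order all_algebra finmap.
From mathcomp Require Import monalg.
From mathcomp Require Import classical_sets fsbigop.

Set Implicit Arguments.
Unset Strict Implicit.
Unset Printing Implicit Defensive.

Import Order.TTheory GRing.Theory.

Local Open Scope ring_scope.

(* Partitions with at most n parts: weakly decreasing n-tuples, padded with   *)
(* zeros. Part number i + 1 of lam is lam i, for i : 'I_n.                    *)

Record intpart (n : nat) := IntPart {
  parts : n.-tuple nat;
  _ : sorted geq parts
}.

HB.instance Definition _ n := [isSub for @parts n].
HB.instance Definition _ n := [Choice of intpart n by <:].

Definition part n (lam : intpart n) (i : 'I_n) : nat := tnth (parts lam) i.
Coercion part : intpart >-> Funclass.

Definition subpart n (mu lam : intpart n) : bool :=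
  [forall i, (mu i <= lam i)%N].

(* Z-linear combinations of the parameters; inl k stands for alpha_k and      *)
(* inr k for beta_k (with k >= 1). {malg param} is the free abelian group.    *)

Definition param : choiceType := (nat + nat)%type.

Definition psumA (k : int) : {malg param} :=
  if k is Posz l then \sum_(1 <= i < l.+1) << inl i : param >> else 0.

Definition psumB (k : int) : {malg param} :=
  if k is Posz l then \sum_(1 <= i < l.+1) << inr i : param >> else 0.

(* Formal power series in one variable t, given by their coefficients.        *)

Section Series.

Variable R : comNzRingType.

Definition ps_one : nat -> R := fun m => (m == 0)%:R.

Definition ps_mul (f g : nat -> R) : nat -> R :=
  fun m => \sum_(i < m.+1) f i * g (m - i)%N.

(* 1 - u t *)
Definition ps_lin (u : R) : nat -> R := fun m => (1 - u *: 'X)`_m.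

(* (1 - u t)^-1 *)
Definition ps_geom (u : R) : nat -> R := fun m => u ^+ m.

Lemma ps_linK (u : R) : ps_mul (ps_lin u) (ps_geom u) =1 ps_one.
Proof.
case=> [|m]; rewrite /ps_mul /ps_lin /ps_geom /ps_one.
  by rewrite big_ord1 !coefE mulr0 subr0 mulr1.
rewrite !big_ord_recl big1 => [|i _]; rewrite !coefE /=.
  by rewrite mulr0 mulr1 subr0 mul1r sub0r addr0 mulNr subn1 -exprS subrr.
by rewrite mulr0 subrr mul0r.
Qed.

(* (1 - u t)^(- c) *)
Definition ps_linX (u : R) (c : int) : nat -> R :=
  match c with
  | Posz k => iter k (ps_mul (ps_geom u)) ps_one
  | Negz k => iter k.+1 (ps_mul (ps_lin u)) ps_one
  end.

Variables alpha beta : nat -> R.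

Definition pval (u : param) : R :=
  match u with inl k => alpha k | inr k => beta k end.

Definition hgen (Z : {malg param}) : nat -> R :=
  \big[ps_mul/ps_one]_(u <- msupp Z) ps_linX (pval u) Z@_u.

Definition hpl (m : int) (Z : {malg param}) : R :=
  if m is Posz k then hgen Z k else 0.

(* As i : 'I_n is 0-based, the index i - 1 of B in the usual 1-based          *)
(* convention is i here; shifting both i and j leaves - i + j unchanged.      *)

Definition cdet n (lam nu : intpart n) : R :=
  \det (\matrix_(i < n, j < n)
    hpl ((lam i)%:Z - (nu j)%:Z - i%:Z + j%:Z)
        (- psumA ((lam i)%:Z - 1) + psumB i%:Z)).

Definition cdet' n (rho mu : intpart n) : R :=
  \det (\matrix_(i < n, j < n)
    hpl ((rho i)%:Z - (mu j)%:Z - i%:Z + j%:Z)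
        (psumA (mu j)%:Z - psumB j%:Z)).

End Series.

(* Skew shapes. The cell (i, j), with i, j >= 1, is encoded by                *)
(* (i - 1, j - 1); crow and ccol give back the 1-based coordinates.           *)

Section Shape.

Variables (n : nat) (lam mu : intpart n).

Definition box : finType := ('I_n * 'I_(\max_i lam i))%type.

Definition cell : finType := {c : box | (mu c.1 <= c.2 < lam c.1)%N}.

Definition crow (c : cell) : nat := (val c).1.+1.
Definition ccol (c : cell) : nat := (val c).2.+1.

Definition is_right (c d : cell) : bool :=
  (crow d == crow c) && (ccol d == (ccol c).+1).
Definition is_above (c d : cell) : bool :=
  ((crow d).+1 == crow c) && (ccol d == ccol c).

Definition filling : choiceType := {ffun cell -> nat}.

Definition positive_filling (T : filling) : bool := [forall c, (0 < T c)%N].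

Definition rows_weak (T : filling) : bool :=
  [forall c, forall d,
    (crow c == crow d) && (ccol c < ccol d)%N ==> (T c <= T d)%N].

Definition cols_weak (T : filling) : bool :=
  [forall c, forall d,
    (ccol c == ccol d) && (crow c < crow d)%N ==> (T c <= T d)%N].

Definition cols_strict (T : filling) : bool :=
  [forall c, forall d,
    (ccol c == ccol d) && (crow c < crow d)%N ==> (T c < T d)%N].

Definition is_rpp (T : filling) : bool :=
  [&& positive_filling T, rows_weak T & cols_weak T].

Definition is_ssyt (T : filling) : bool :=
  [&& positive_filling T, rows_weak T & cols_strict T].

(* A filling together with its set of marked cells. *)
Definition marked : choiceType := (filling * {set cell})%type.

Definition is_mrpp (T : marked) : bool :=
  is_rpp T.1 &&
  [forall c in T.2, [exists d, is_right c d && (T.1 c == T.1 d)]].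

End Shape.

(* A formal power series in x_1, x_2, ... over R is the function giving the   *)
(* coefficient of each monomial; {cmonom nat} is the type of finitely         *)
(* supported exponent functions (x_0 is never used).                          *)

Section Tableaux.

Variable R : comNzRingType.

Definition xseries := {cmonom nat} -> R.

Definition xvar (k : nat) : {malg R[{cmonom nat}]} := << ucm k >>.

Variables alpha beta : nat -> R.
Variables (n : nat) (lam mu : intpart n).

Definition wcell (T : marked lam mu) (c : cell lam mu) :
    {malg R[{cmonom nat}]} :=
  if c \in T.2 then (- alpha (ccol c))%:MP
  else if [exists d, is_above c d && (T.1 d == T.1 c)] then
    (beta (crow c).-1)%:MP
  else xvar (T.1 c).

Definition wt (T : marked lam mu) : {malg R[{cmonom nat}]} :=
  \prod_c wcell T c.

(* The sums over \in sum the finitely many nonzero terms. Here all but        *)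
(* finitely many terms vanish for each m: every value v of T contributes      *)
(* at least one factor x_v to wt T (from a cell containing v, move right as   *)
(* long as the entry is v, then up, and repeat; the last cell has weight      *)
(* x_v), so T contributes to m only if its values are in the support of m.    *)

Definition gskew : xseries := fun m =>
  if subpart mu lam then
    \sum_(T \in [set T : marked lam mu | is_mrpp T]%classic) (wt T)@_m
  else 0.

Definition sskew : xseries := fun m =>
  if subpart mu lam then
    \sum_(T \in [set T : filling lam mu | is_ssyt T]%classic)
      (\prod_c xvar (T c))@_m
  else 0.

End Tableaux.

(* Main.v *)
(* Both sides satisfy a branching rule in the variables x_1, x_2, ..., since   *)
(* the entries at most k of a reverse plane partition fill a subshape and the  *)
(* weight of a cell only involves neighbours with the same entry. So the       *)
(* coefficient of a monomial in x_1, ..., x_K is an entry of the product of    *)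
(* the one-variable transfer matrices G(x_K) ... G(x_1), and likewise          *)
(* S(x_K) ... S(x_1) for the Schur side, where S is G at alpha = beta = 0.     *)
(*   The one-variable function G(x)_{lam,mu} is a product over cells, and      *)
(* column operations show that it equals the determinant of                    *)
(*   h_{lam_i - mu_j - i + j}[x - A_{lam_i - 1} + A_{mu_j} + B_{i-1} - B_{j-1}].*)
(* By Cauchy-Binet, G(x) = C S(x) C'. At x = 0 both G and S are the identity,  *)
(* hence C C' = 1, so C' C = 1, and the product of the G(x_k) telescopes to    *)
(* C S(x_K) ... S(x_1) C'.                                                     *)

From HB Require Import structures.
Require Import Defs.
From mathcomp Require Import all_boot all_order all_algebra finmap.
From mathcomp Require Import monalg.
From mathcomp Require Import classical_sets fsbigop.
From mathcomp Require Import fingroup perm boolp ring zify.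
Set Implicit Arguments.
Unset Strict Implicit.
Unset Printing Implicit Defensive.
Import Order.TTheory GRing.Theory.
Local Open Scope ring_scope.

(** * Power series in one variable *)

(** With a single letter of weight x the marks are chosen cell by cell, so the generating function
    [gone] is a product over cells. [det_xmx] turns it into a determinant of complete functions
    whose argument is x plus a row part [zrow] and a column part [zcol]. A sum of arguments is a
    product of series, so this matrix is a product of three ([xmx_factor]), and two applications of
    [det_cauchy_binet] give G(x) = C S(x) C' ([gone_factor]), where C and C' have entries [cdet] and
    [cdet'].

    At x = 0 every nonempty skew shape contains a cell of weight 0 ([gone0]), so C C' = 1. On the
    partitions inside a fixed box these are finite square matrices over a commutative ring; hence C'
    C = 1 as well, and the inner factors of a product of matrices G cancel ([gpath_factor]).

    Several letters are handled by branching: the entries at most K of a reverse plane partition of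
    shape lam/mu fill some nu/mu, the entries K+1 fill lam/nu, and the weight factors because only
    equal neighbours interact ([gsum_rec]). A fixed monomial involves finitely many variables, and
    fillings with other entries do not contribute to it ([wt_large]). Thus [gskew] and [sskew] are
    coefficients of finite sums ([gskew_gsum], [sskew_gsum]) to which [gpath_factor] applies. *)

Section SeriesTheory.
Variable R : comNzRingType.
Implicit Types (f g h : nat -> R) (u x y : R).

Lemma ps_mulC : commutative (@ps_mul R).
Proof.
move=> f g; apply/funext=> m; rewrite /ps_mul (reindex_inj rev_ord_inj) /=.
by apply: eq_bigr => i _; rewrite subSS subKn -1?ltnS // mulrC.
Qed.

Definition ps_poly m f : {poly R} := \poly_(i < m.+1) f i.

Lemma coef_ps_mul m k f g : (k <= m)%N ->
  (ps_poly m f * ps_poly m g)`_k = ps_mul f g k.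
Proof.
move=> km; rewrite coefM; apply: eq_bigr => i _.
rewrite !coef_poly !ltnS leq_subLR (leq_trans (leq_ord i)) //.
by rewrite (leq_trans km (leq_addl _ _)).
Qed.

(** Coefficient m depends only on truncations at degree m, where [ps_mul] is multiplication of
    polynomials. *)
Lemma ps_mulA : associative (@ps_mul R).
Proof.
move=> f g h; apply/funext=> m.
have E (p q : {poly R}) : (forall i, (i <= m)%N -> p`_i = q`_i) ->
    forall r : {poly R}, (p * r)`_m = (q * r)`_m.
  by move=> e r; rewrite !coefM; apply: eq_bigr => i _; rewrite e // -ltnS.
have P f1 f2 i : (i <= m)%N ->
    (ps_poly m (ps_mul f1 f2))`_i = (ps_poly m f1 * ps_poly m f2)`_i.
  by move=> im; rewrite coef_poly ltnS im coef_ps_mul.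
rewrite -(coef_ps_mul _ _ (leqnn m)) -[RHS](coef_ps_mul _ _ (leqnn m)) mulrC.
by rewrite (E _ _ (P g h)) (E _ _ (P f g)) mulrC mulrA.
Qed.

Lemma ps_mul1f : left_id (@ps_one R) (@ps_mul R).
Proof.
move=> f; apply/funext=> m; rewrite /ps_mul /ps_one big_ord_recl subn0 mul1r.
by rewrite big1 ?addr0 // => i _; rewrite mul0r.
Qed.

HB.instance Definition _ :=
  Monoid.isComLaw.Build (nat -> R) (@ps_one R) (@ps_mul R) ps_mulA ps_mulC ps_mul1f.

Lemma ps_mulCA : left_commutative (@ps_mul R).
Proof. by move=> f g h; rewrite !ps_mulA (ps_mulC f). Qed.

Lemma ps_mulf1 : right_id (@ps_one R) (@ps_mul R).
Proof. by move=> f; rewrite ps_mulC ps_mul1f. Qed.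

Lemma ps_linK' u : ps_mul (ps_lin u) (ps_geom u) = @ps_one R.
Proof. exact/funext/ps_linK. Qed.

Lemma ps_linXS u (c : int) : ps_linX u (c + 1) = ps_mul (ps_geom u) (ps_linX u c).
Proof.
case: c => [k|k]; first by rewrite -PoszD addn1.
have ->: Negz k + 1 = - Posz k by rewrite NegzE -addn1 PoszD opprD addrNK.
rewrite [ps_linX u (Negz k)]/= ps_mulA [ps_mul (ps_geom u) _]ps_mulC ps_linK' ps_mul1f.
by case: k.
Qed.

Lemma ps_linXB u (c : int) : ps_linX u (c - 1) = ps_mul (ps_lin u) (ps_linX u c).
Proof. by rewrite -[in RHS](subrK 1 c) ps_linXS ps_mulA ps_linK' ps_mul1f. Qed.

Lemma ps_linXD u (c d : int) :
  ps_linX u (c + d) = ps_mul (ps_linX u c) (ps_linX u d).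
Proof.
elim/int_rect: c => [|k IH|k IH]; first by rewrite add0r /= ps_mul1f.
  by rewrite -addn1 PoszD addrAC !ps_linXS IH ps_mulA.
by rewrite -addn1 PoszD opprD addrAC !ps_linXB IH ps_mulA.
Qed.

Variables alpha beta : nat -> R.
Local Notation hgen := (hgen alpha beta).
Local Notation pval := (Defs.pval alpha beta).
Implicit Types Z W : {malg param}.

(** Parameters outside the support have exponent 0. Over a common index set, [hgenD] becomes a
    factorwise computation. *)
Lemma hgenEw Z (D : {fset param}) : (msupp Z `<=` D)%fset ->
  hgen Z = \big[@ps_mul R/@ps_one R]_(u <- D) ps_linX (pval u) Z@_u.
Proof.
move=> sZD; rewrite /Defs.hgen; apply/big_fset_incl => // u _ uZ.
by rewrite mcoeff_outdom.
Qed.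

Lemma hgenD Z W : hgen (Z + W) = ps_mul (hgen Z) (hgen W).
Proof.
rewrite (hgenEw (msuppD_le Z W)) (hgenEw (fsubsetUl (msupp Z) (msupp W))).
rewrite (hgenEw (fsubsetUr (msupp Z) (msupp W))) -big_split /=.
by apply: eq_bigr => u _; rewrite mcoeffD ps_linXD.
Qed.

Lemma hgen0 : hgen 0 = @ps_one R.
Proof. by rewrite /Defs.hgen msupp0 big_seq_fset0. Qed.

Lemma hgenU (u : param) : hgen << u >> = ps_geom (pval u).
Proof.
by rewrite /Defs.hgen msuppU oner_eq0 big_seq_fset1 mcoeffUU /= ps_mulf1.
Qed.

Lemma hgenNU (u : param) : hgen (- << u >>) = ps_lin (pval u).
Proof.
by rewrite /Defs.hgen msuppN msuppU oner_eq0 big_seq_fset1 mcoeffN mcoeffUU /= ps_mulf1.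
Qed.

Lemma hgen_sum I (s : seq I) (F : I -> {malg param}) :
  hgen (\sum_(i <- s) F i) = \big[@ps_mul R/@ps_one R]_(i <- s) hgen (F i).
Proof. exact: (big_morph _ hgenD hgen0). Qed.

End SeriesTheory.

(** * Determinants *)

Section PermDet.
Variables (R : comNzRingType) (n : nat).

Lemma perm_leq_id (s : 'S_n) : (forall i, (s i <= i)%N) -> s = 1%g.
Proof.
move=> sle; apply/permP=> i; rewrite perm1.
have [k] := ubnP (i : nat); elim: k i => // k IH i ik.
have:= sle i; rewrite leq_eqVlt => /orP[/eqP /val_inj //|ltsi].
have /perm_inj := IH (s i) (leq_trans ltsi ik).
by move=> e; rewrite e ltnn in ltsi.
Qed.

(** A permutation [s] other than 1 has some [i0] with j = s i0 > i0. If column j vanishes above the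
    diagonal, the factor at [i0] is 0. Otherwise [s] either meets the zero block or preserves the
    set of indices at least j; the latter is impossible, since j is the image of the smaller
    [i0]. *)
Lemma det_zero_or_block (A : 'M[R]_n) :
  (forall j : 'I_n, (forall i : 'I_n, (i < j)%N -> A i j = 0) \/
    (forall i k : 'I_n, (j <= i)%N -> (k < j)%N -> A i k = 0)) ->
  \det A = \prod_i A i i.
Proof.
move=> H; rewrite /determinant (bigD1 1%g) //= [X in _ + X]big1 ?addr0 => [|s sn1].
  by rewrite odd_perm1 mul1r; apply: eq_bigr => i _; rewrite perm1.
have [i0 lti0]: exists i0 : 'I_n, (i0 < s i0)%N.
  apply/existsP; apply: contraNT sn1; rewrite negb_exists => /forallP h.
  by apply/eqP/perm_leq_id => i; rewrite leqNgt h.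
suff [i Ai0]: exists i, A i (s i) = 0 by rewrite (bigD1 i) //= Ai0 mul0r mulr0.
have [H1|H2] := H (s i0); first by exists i0; exact: H1.
have [/existsP[i /andP[h1 h2]]|] :=
    boolP [exists i : 'I_n, (s i0 <= i)%N && (s i < s i0)%N].
  by exists i; exact: H2.
rewrite negb_exists => /forallP h.
pose S := [set i : 'I_n | (s i0 <= i)%N].
have /eqP eS : s @: S == S.
  rewrite eqEcard card_imset ?leqnn ?andbT; last exact: perm_inj.
  apply/fintype.subsetP=> _ /imsetP[i iS ->]; move: iS (h i); rewrite !inE => -> /=.
  by rewrite -leqNgt.
have: s i0 \in S by rewrite inE.
rewrite -{1}eS => /imsetP[i iS /perm_inj e].
by move: iS; rewrite inE -e leqNgt lti0.
Qed.

(** Pigeonhole: a permutation avoiding the zero corner would send the n - k rows from k on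
    injectively into the n - k - 1 columns after k. *)
Lemma det_zero_corner (A : 'M[R]_n) (k : 'I_n) :
  (forall i j : 'I_n, (k <= i)%N -> (j <= k)%N -> A i j = 0) -> \det A = 0.
Proof.
move=> H; rewrite /determinant big1 // => s _.
suff [i Ai0]: exists i, A i (s i) = 0 by rewrite (bigD1 i) //= Ai0 mul0r mulr0.
have [/existsP[i /andP[h1 h2]]|] :=
    boolP [exists i : 'I_n, (k <= i)%N && (s i <= k)%N].
  by exists i; exact: H.
rewrite negb_exists => /forallP h.
pose S := [set i : 'I_n | (k <= i)%N].
have sS : s @: S \subset S :\ k.
  apply/fintype.subsetP=> _ /imsetP[i iS ->]; move: iS (h i); rewrite !inE => -> /=.
  by rewrite -ltnNge => lt; rewrite ltnW // andbT -(inj_eq val_inj) gtn_eqF.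
have := subset_leq_card sS; rewrite card_imset; last exact: perm_inj.
by rewrite (cardsD1 k S) inE leqnn ltnn.
Qed.
End PermDet.

(** * Partitions as sequences on the natural numbers *)

Section Parts.
Variable n : nat.
Implicit Types lam mu nu : intpart n.

(** Total in [i], with value 0 from [n] on, so that neighbouring rows need no bound on the index. *)
Definition pt lam (i : nat) : nat := nth 0%N (parts lam) i.

Lemma partE lam (i : 'I_n) : lam i = pt lam i.
Proof. by rewrite /part (tnth_nth 0%N). Qed.

Lemma pt_anti lam i j : (i <= j)%N -> (pt lam j <= pt lam i)%N.
Proof.
move=> ij; rewrite /pt; case: (ltnP j n) => jn; last first.
  by rewrite nth_default // size_tuple.
have := valP lam; rewrite sorted_pairwise; last by move=> a b c /= ? /leq_trans; apply.
move=> /(pairwiseP 0%N) h; case: (ltngtP i j) ij => // [ij _|-> //].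
by apply: h; rewrite ?inE ?size_tuple // (ltn_trans ij).
Qed.

Lemma subpartP mu lam :
  reflect (forall i, pt mu i <= pt lam i)%N (subpart mu lam).
Proof.
apply: (iffP forallP) => h i; last by rewrite !partE.
case: (ltnP i n) => ni; first by have := h (Ordinal ni); rewrite !partE.
by rewrite /pt !nth_default // size_tuple.
Qed.

Lemma subpart_refl lam : subpart lam lam.
Proof. exact/subpartP. Qed.

Lemma subpart_trans lam mu nu : subpart nu mu -> subpart mu lam -> subpart nu lam.
Proof.
by move=> /subpartP h1 /subpartP h2; apply/subpartP=> i; apply: leq_trans (h2 i).
Qed.

Lemma intpart_eqP lam mu : (forall i, (i < n)%N -> pt lam i = pt mu i) -> lam = mu.
Proof.
move=> h; apply: val_inj; apply: eq_from_tnth => i.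
by rewrite !(tnth_nth 0%N); exact: h.
Qed.

Lemma subpart_anti lam mu : subpart lam mu -> subpart mu lam -> lam = mu.
Proof.
move=> /subpartP h1 /subpartP h2; apply: intpart_eqP => i _.
by apply/eqP; rewrite eqn_leq h1 h2.
Qed.
End Parts.

(** * The one-variable determinant *)

Section OneVariable.
Variable R : comNzRingType.
Implicit Types (f g : nat -> R) (x y : R).

Definition pcoef f (m : int) : R := if m is Posz k then f k else 0.

Lemma pcoef_lt0 f m : (m < 0)%R -> pcoef f m = 0.
Proof. by case: m. Qed.

Lemma coefS_ps_lin u f k : ps_mul (ps_lin u) f k.+1 = f k.+1 - u * f k.
Proof.
rewrite /ps_mul !big_ord_recl big1 => [|i _]; rewrite /ps_lin !coefE /=.
  by rewrite mulr0 subr0 mul1r mulr1 sub0r mulNr addr0 subn0 subn1.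
by rewrite mulr0 subrr mul0r.
Qed.

Lemma coef0_ps_mul f g : ps_mul f g 0%N = f 0%N * g 0%N.
Proof. by rewrite /ps_mul big_ord1. Qed.

Definition ps_lins (I : Type) (s : seq I) (F : I -> R) :=
  \big[@ps_mul R/@ps_one R]_(i <- s) ps_lin (F i).

(** Multiplying by 1 - u t turns coefficients c x^k into c x^(k-1) (x - u), once k is past the
    initial degrees. *)
Lemma coef_geom_lins x (I : Type) (s : seq I) (F : I -> R) k : (size s <= k)%N ->
  ps_mul (ps_geom x) (ps_lins s F) k = x ^+ (k - size s) * \prod_(i <- s) (x - F i).
Proof.
elim: s k => [|i s IH] k /=.
  by move=> _; rewrite /ps_lins !big_nil ps_mulf1 mulr1 subn0.
case: k => // k sk; rewrite /ps_lins !big_cons ps_mulCA coefS_ps_lin.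
rewrite !IH ?(ltnW sk) // subSn // exprS subSS; ring.
Qed.

(** Partial fractions for 1/((1 - x t)(1 - y t)), with the denominator x - y cleared. *)
Lemma coef_geom2 x y f k :
  (x - y) * ps_mul (ps_geom x) (ps_mul (ps_geom y) f) k =
  ps_mul (ps_geom x) f k.+1 - ps_mul (ps_geom y) f k.+1.
Proof.
set h := ps_mul (ps_geom x) (ps_mul (ps_geom y) f).
have -> : ps_mul (ps_geom x) f = ps_mul (ps_lin y) h.
  by rewrite /h [RHS]ps_mulCA [X in _ = ps_mul _ X]ps_mulA ps_linK' ps_mul1f.
have -> : ps_mul (ps_geom y) f = ps_mul (ps_lin x) h.
  by rewrite /h [RHS]ps_mulA ps_linK' ps_mul1f.
by rewrite !coefS_ps_lin; ring.
Qed.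

Variables alpha beta : nat -> R.
Variable n : nat.
Implicit Types lam mu nu : intpart n.
Local Notation hgen := (hgen alpha beta).

Lemma hgen_coef0 Z : hgen Z 0%N = 1.
Proof.
rewrite /Defs.hgen; elim/big_rec: _ => [|u f _ IH]; first by [].
rewrite coef0_ps_mul IH mulr1; elim/int_rect: (Z@_u) => [|k E|k E] //.
  by rewrite -addn1 PoszD ps_linXS coef0_ps_mul E mulr1.
rewrite -addn1 PoszD opprD ps_linXB coef0_ps_mul E mulr1 /ps_lin !coefE /=.
by rewrite mulr0 subr0.
Qed.

Lemma hgenN_alpha a b : hgen (- \sum_(a <= k < b) << inl k : param >>) =
  ps_lins (index_iota a b) alpha.
Proof. by rewrite -sumrN hgen_sum; apply: eq_bigr => k _; rewrite hgenNU. Qed.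

Lemma hgenN_beta a b : hgen (- \sum_(a <= k < b) << inr k : param >>) =
  ps_lins (index_iota a b) beta.
Proof. by rewrite -sumrN hgen_sum; apply: eq_bigr => k _; rewrite hgenNU. Qed.

Definition zrow lam (i : 'I_n) : {malg param} :=
  - psumA ((lam i)%:Z - 1) + psumB i%:Z.
Definition zcol mu (j : 'I_n) : {malg param} :=
  psumA (mu j)%:Z - psumB j%:Z.

Definition xmx x lam mu : 'M[R]_n := \matrix_(i, j)
  pcoef (ps_mul (ps_geom x) (hgen (zrow lam i + zcol mu j)))
    ((lam i)%:Z - (mu j)%:Z - i%:Z + j%:Z).

Lemma psumA_sub a b : (0 < a)%N -> (b < a)%N ->
  - psumA (a%:Z - 1) + psumA b%:Z = - \sum_(b.+1 <= k < a) << inl k : param >>.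
Proof.
case: a => // a _ ba; have -> : a.+1%:Z - 1 = a%:Z by lia.
rewrite /psumA (@big_cat_nat _ _ _ b.+1 1 a.+1) //=.
by rewrite opprD addrAC addNr add0r.
Qed.

Lemma psumB_sub a b : (a <= b)%N ->
  psumB a%:Z - psumB b%:Z = - \sum_(a.+1 <= k < b.+1) << inr k : param >>.
Proof.
move=> ab; rewrite /psumB (@big_cat_nat _ _ _ a.+1 1 b.+1) //=.
by rewrite opprD addrA subrr add0r.
Qed.

Lemma zrowcol lam mu i j : zrow lam i + zcol mu j =
  (- psumA ((lam i)%:Z - 1) + psumA (mu j)%:Z) + (psumB i%:Z - psumB j%:Z).
Proof. by rewrite /zrow /zcol addrACA. Qed.

(** All parameters occur here with a negative sign, and the degree exceeds their number by exactly
    one, which leaves a single factor [x]. *)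
Lemma xmx_upper x lam mu (i j : 'I_n) : (i <= j)%N -> (mu j < lam i)%N ->
  xmx x lam mu i j = x * (\prod_((mu j).+1 <= k < lam i) (x - alpha k) *
                          \prod_(i.+1 <= k < j.+1) (x - beta k)).
Proof.
move=> ij ml; rewrite mxE zrowcol psumA_sub ?(leq_trans _ ml) // psumB_sub //.
rewrite hgenD hgenN_alpha hgenN_beta.
pose s : seq (nat + nat) := map inl (index_iota (mu j).+1 (lam i)) ++
                            map inr (index_iota i.+1 j.+1).
pose F (u : nat + nat) := match u with inl k => alpha k | inr k => beta k end.
have -> : ps_mul (ps_lins (index_iota (mu j).+1 (lam i)) alpha)
                 (ps_lins (index_iota i.+1 j.+1) beta) = ps_lins s F.
  by rewrite /ps_lins big_cat !big_map.
have ss : size s = (lam i - (mu j).+1 + (j - i))%N.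
  by rewrite size_cat !size_map !size_iota subSS.
have -> : (lam i)%:Z - (mu j)%:Z - i%:Z + j%:Z = (size s).+1%:Z by rewrite ss; lia.
by rewrite /= coef_geom_lins ?leqnSn // subSn // subnn expr1 big_cat !big_map.
Qed.

Lemma xmx_diag1 x lam mu (i : 'I_n) : mu i = lam i -> xmx x lam mu i i = 1.
Proof.
move=> e; rewrite mxE e.
have -> : (lam i)%:Z - (lam i)%:Z - i%:Z + i%:Z = 0 by lia.
by rewrite /= coef0_ps_mul hgen_coef0 mulr1.
Qed.

(** Just below the diagonal one parameter, [beta i], occurs with a positive sign; [coef_geom2]
    separates it from [x]. *)
Lemma xmx_subdiag x lam mu (i j : 'I_n) : j.+1 = i -> (mu j < lam i)%N ->
  (x - beta i) * xmx x lam mu i j =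
  x * \prod_((mu j).+1 <= k < lam i) (x - alpha k) -
  beta i * \prod_((mu j).+1 <= k < lam i) (beta i - alpha k).
Proof.
move=> ij ml; rewrite mxE zrowcol psumA_sub ?(leq_trans _ ml) //.
have -> : psumB i%:Z - psumB j%:Z = << inr (i : nat) : param >>.
  by rewrite -ij /psumB [X in X - _]big_nat_recr //= addrAC subrr add0r.
rewrite hgenD hgenN_alpha hgenU /= [X in ps_mul (ps_geom x) X]ps_mulC.
set s := index_iota _ _.
have ss : size s = (lam i - (mu j).+1)%N by rewrite size_iota.
have -> : (lam i)%:Z - (mu j)%:Z - i%:Z + j%:Z = (size s)%:Z by rewrite ss; lia.
rewrite /= coef_geom2 !coef_geom_lins ?leqnSn //.
by rewrite subSn // subnn !expr1.
Qed.

Lemma xmx_lower x lam mu (i j : 'I_n) : (lam i <= mu j)%N -> (j < i)%N ->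
  xmx x lam mu i j = 0.
Proof. by move=> h1 h2; rewrite mxE pcoef_lt0 //; lia. Qed.

(* The sum of the weights of the cell (i + 1, c + 1), marked and unmarked, when *)
(* lam/mu is filled with copies of a single letter of weight x.                 *)
Definition gcell x lam mu (i c : nat) : R :=
  (if (c.+1 < pt lam i)%N then - alpha c.+1 else 0) +
  (if (0 < i)%N && (pt mu i.-1 <= c)%N then beta i else x).

Definition gone x lam mu : R :=
  if subpart mu lam then
    \prod_(0 <= i < n) \prod_(pt mu i <= c < pt lam i) gcell x lam mu i c
  else 0.

(** The last cell of a row has no right neighbour, so it cannot be marked and contributes [y]
    alone. *)
Lemma prod_strip y a b :
  \prod_(a <= c < b) ((if (c.+1 < b)%N then - alpha c.+1 else 0) + y) =
  if (a < b)%N then y * \prod_(a.+1 <= k < b) (y - alpha k) else 1.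
Proof.
case: ltnP => [|ba]; last by rewrite big_geq.
case: b => // b; rewrite ltnS => ab.
rewrite big_nat_recr //= ltnn add0r mulrC big_add1 /=; congr (_ * _).
by apply: eq_big_nat => c /andP[_ cb]; rewrite ltnS cb addrC.
Qed.

(** For [mu] inside [lam]: rows [i.-1] and [i] of the skew shape have a column in common. *)
Definition overlap lam mu (i : nat) := (0 < i)%N && (pt mu i.-1 < pt lam i)%N.

(** Cut the row at column [pt mu i.-1]: before it no cell has a cell above, after it every cell
    does. When the rows overlap, all cells of the first piece have a right neighbour. *)
Lemma prod_gcell_row x lam mu i : (pt mu i <= pt lam i)%N ->
  \prod_(pt mu i <= c < pt lam i) gcell x lam mu i c =
  if overlap lam mu i then
    \prod_((pt mu i).+1 <= k < (pt mu i.-1).+1) (x - alpha k) *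
    (beta i * \prod_((pt mu i.-1).+1 <= k < pt lam i) (beta i - alpha k))
  else if (pt mu i < pt lam i)%N then
    x * \prod_((pt mu i).+1 <= k < pt lam i) (x - alpha k)
  else 1.
Proof.
move=> ml; rewrite /overlap; case: ifP => [/andP[i0 ov]|nov]; last first.
  rewrite -prod_strip; apply: eq_big_nat => c /andP[_ cl]; rewrite /gcell.
  case: (ltnP 0 i) nov => //= _ /negbT; rewrite -leqNgt => h.
  suff -> : (pt mu i.-1 <= c)%N = false by [].
  by apply/negbTE; rewrite -ltnNge (leq_trans cl h).
rewrite (@big_cat_nat _ _ _ (pt mu i.-1)) ?pt_anti ?leq_pred ?(ltnW ov) //=.
congr (_ * _).
  rewrite [RHS]big_add1 /=; apply: eq_big_nat => c /andP[_ cm].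
  by rewrite /gcell (leq_ltn_trans cm ov) i0 leqNgt cm /= addrC.
transitivity (if (pt mu i.-1 < pt lam i)%N then beta i *
    \prod_((pt mu i.-1).+1 <= k < pt lam i) (beta i - alpha k) else 1);
  last by rewrite ov.
rewrite -prod_strip; apply: eq_big_nat => c /andP[mc _].
by rewrite /gcell i0 mc.
Qed.

(** If [mu] is not inside [lam], the matrix has a zero corner. Otherwise unimodular column
    operations bring it to the form of [det_zero_or_block], and its diagonal entries are the row
    products of [prod_gcell_row]. *)
Lemma det_xmx x lam mu : \det (xmx x lam mu) = gone x lam mu.
Proof.
rewrite /gone; case: ifPn => [/subpartP ml|]; last first.
  rewrite /subpart negb_forall => /existsP[k]; rewrite -ltnNge !partE => lk.
  apply: (det_zero_corner (k := k)) => i j ki jk; rewrite mxE pcoef_lt0 //.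
  rewrite !partE; have := pt_anti lam ki; have := pt_anti mu jk; lia.
(* Column j-1 times c j cancels the entries of column j above the diagonal,    *)
(* provided rows j-1 and j of lam/mu overlap; without an overlap the entries in *)
(* rows at least j and columns less than j vanish.                              *)
pose c (j : 'I_n) := (x - beta j) *
  \prod_((pt mu j).+1 <= k < (pt mu j.-1).+1) (x - alpha k).
pose V : 'M[R]_n := \matrix_(k, j)
  (if (k.+1 == j) && overlap lam mu j then c j else 0).
pose A := xmx x lam mu *m (1%:M - V).
have AE (i j : 'I_n) : A i j = xmx x lam mu i j -
    \sum_(k < n) (if (k.+1 == j) && overlap lam mu j then xmx x lam mu i k * c j else 0).
  rewrite /A mulmxBr mulmx1 mxE [in X in _ + X]mxE [in X in _ + - X]mxE.
  congr (_ + - _). apply: eq_bigr => k _.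
  by rewrite [V _ _]mxE; case: ifP; rewrite ?mulr0.
have A_nov (i j : 'I_n) : ~~ overlap lam mu j -> A i j = xmx x lam mu i j.
  by move=> /negbTE nov; rewrite AE big1 ?subr0 // => k _; rewrite nov andbF.
have A_ov (i k j : 'I_n) : k.+1 = j -> overlap lam mu j ->
    A i j = xmx x lam mu i j - xmx x lam mu i k * c j.
  move=> kj ov; rewrite AE (bigD1 k) //= kj eqxx ov big1 ?addr0 // => k' nk.
  by rewrite -kj eqSS (inj_eq val_inj) (negbTE nk).
have pred (j : 'I_n) : (0 < j)%N -> exists2 k : 'I_n, k.+1 = j & k = j.-1 :> nat.
  move=> j0; have kn: (j.-1 < n)%N by rewrite prednK // ltnW.
  by exists (Ordinal kn) => //=; rewrite prednK.
(* [V] lives just above the diagonal, so this matrix is unitriangular. *)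
have dU : \det (1%:M - V) = 1.
  rewrite -det_tr det_trig; last first.
    apply/is_trig_mxP => i j ij; rewrite !mxE.
    rewrite eq_sym -(inj_eq val_inj) /= ltn_eqF // sub0r.
    by case: eqP => [e|_] /=; rewrite ?oppr0 //; lia.
  by rewrite big1 // => i _; rewrite !mxE eqxx gtn_eqF //= subr0.
have -> : \det (xmx x lam mu) = \det A by rewrite det_mulmx dU mulr1.
rewrite det_zero_or_block => [|j].
  rewrite big_mkord; apply: eq_bigr => i _; rewrite prod_gcell_row //.
  case: ifPn => [ov|nov]; last first.
    rewrite A_nov //; case: ltnP => h.
      by rewrite xmx_upper ?partE // [X in _ * (_ * X)]big_geq // mulr1.
    by rewrite xmx_diag1 // !partE; apply/eqP; rewrite eqn_leq h ml.
  have /andP[i0 ov'] := ov; have [k ki ki'] := pred i i0.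
  have le1 : (pt mu i <= pt mu i.-1)%N by rewrite pt_anti ?leq_pred.
  rewrite (A_ov _ k) // xmx_upper ?partE ?(leq_ltn_trans le1) //.
  rewrite [X in _ * (_ * X)]big_geq // mulr1 /c.
  rewrite (@big_cat_nat _ _ _ (pt mu i.-1).+1 (pt mu i).+1) //=.
  have := @xmx_subdiag x lam mu i k ki; rewrite !partE ki' => /(_ ov').
  move: (xmx _ _ _ _ _) (\prod_(_ <= _ < _) _).
  move: (\prod_(_ <= _ < _) _) (\prod_(_ <= _ < _) _).
  move=> P1 P3 M P2 E.
  (* By [xmx_subdiag] the bracket is beta_i times the product over the columns with a cell above. *)
  transitivity (P1 * (x * P2 - (x - beta i) * M)); first by ring.
  by rewrite E; ring.
have [ov|nov] := boolP (overlap lam mu j).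
  left=> i ij; have /andP[j0 ov'] := ov; have [k kj kj'] := pred j j0.
  have ik : (i <= k)%N by rewrite -ltnS kj.
  have le1 : (pt mu j <= pt mu k)%N by rewrite pt_anti // -kj.
  have le2 : (pt mu k < pt lam i)%N.
    by rewrite kj' (leq_trans ov') // pt_anti // ltnW.
  rewrite (A_ov _ k) // !xmx_upper ?partE ?(leq_ltn_trans le1) // ?(ltnW ij) //.
  rewrite /c -kj' (@big_cat_nat _ _ _ (pt mu k).+1 (pt mu j).+1) //=.
  by rewrite -kj [X in _ * (_ * X)]big_nat_recr //=; ring.
case: (ltnP 0 j) nov => [j0|j0]; rewrite /overlap ?j0 /=; last first.
  by move=> _; left=> i; rewrite ltnNge (leq_trans j0).
rewrite -leqNgt => lm; right=> i k ji kj.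
have le1 (k' : 'I_n) : (k' < j)%N -> xmx x lam mu i k' = 0.
  move=> k'j; rewrite xmx_lower ?partE ?(leq_trans k'j) //.
  apply: leq_trans (pt_anti lam ji) (leq_trans lm _).
  by apply: pt_anti; rewrite -ltnS prednK.
have [ov|nov] := boolP (overlap lam mu k); last by rewrite A_nov // le1.
have /andP[k0 _] := ov; have [k' k'k _] := pred k k0.
by rewrite (A_ov _ k') // !le1 ?mul0r ?subr0 // (leq_trans _ kj) // -k'k ltnS.
Qed.
End OneVariable.

(** * The Cauchy-Binet formula *)

Section CauchyBinet.
Variables (R : comNzRingType) (n N : nat).

Definition sdecr (f : {ffun 'I_n -> 'I_N}) : bool :=
  [forall i : 'I_n, forall j : 'I_n, (i < j)%N ==> (f j < f i)%N].

Lemma sdecrP (f : {ffun 'I_n -> 'I_N}) :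
  reflect (forall i j : 'I_n, (i < j)%N -> (f j < f i)%N) (sdecr f).
Proof.
apply: (iffP forallP) => h i; last by apply/forallP=> j; apply/implyP/h.
by move=> j; apply/implyP/(forallP (h i)).
Qed.

Lemma sdecr_inj (f : {ffun 'I_n -> 'I_N}) : sdecr f -> injective f.
Proof.
move=> /sdecrP h i j e; apply: val_inj => /=.
by case: (ltngtP i j) => // /h; rewrite e ltnn.
Qed.

Let gtI : rel 'I_N := fun a b => (b < a)%N.
Let gtI_trans : transitive gtI.
Proof. by move=> a b c /= ? ?; apply: ltn_trans; eassumption. Qed.

Let enum_sorted : sorted (fun i j : 'I_n => (i < j)%N) (enum 'I_n).
Proof. by have := iota_ltn_sorted 0 n; rewrite -val_enum_ord sorted_map. Qed.

Lemma sdecr_codom_eq f g : sdecr f -> sdecr g -> codom f =i codom g -> f = g.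
Proof.
have cs h : sdecr h -> sorted gtI (codom h).
  move=> /sdecrP hd; rewrite sorted_map; apply: sub_sorted enum_sorted.
  by move=> i j /= /hd.
move=> /cs fs /cs gs e; have {e} e : codom f = codom g.
  by apply: (irr_sorted_eq gtI_trans) => // a; rewrite /gtI ltnn.
by apply/ffunP=> i; move/eq_in_map: e => -> //; rewrite mem_enum.
Qed.

(** Take for [d] the values of [f] sorted in decreasing order. *)
Lemma inj_sdecr_perm (f : {ffun 'I_n -> 'I_N}) : injective f ->
  exists2 d, sdecr d & exists s : 'S_n, f = [ffun i => d (s i)].
Proof.
move=> fi; pose ge : rel 'I_N := fun a b => (b <= a)%N.
have sz : size (sort ge (codom f)) == n by rewrite size_sort size_codom card_ord.
have szf : size (codom f) == n by rewrite size_codom card_ord.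
have /tuple_permP[s es] : perm_eq (Tuple szf) (Tuple sz).
  by rewrite /= perm_sym perm_sort.
have fE i : f i = tnth (Tuple sz) (s i).
  have := congr1 (fun q => nth (f i) q i) es.
  rewrite -[RHS]tnth_nth [RHS]tnth_mktuple => <-.
  by rewrite /= (nth_map i) ?size_enum_ord // nth_ord_enum.
exists [ffun i => tnth (Tuple sz) i]; last first.
  by exists s; apply/ffunP=> i; rewrite !ffunE fE.
apply/sdecrP=> i j ij; rewrite !ffunE !(tnth_nth (f i)) /=.
have us : uniq (sort ge (codom f)) by rewrite sort_uniq map_inj_uniq ?enum_uniq.
have ss : sorted ge (sort ge (codom f)) by apply: sort_sorted => a b; exact: leq_total.
have js : (j < size (sort ge (codom f)))%N by rewrite (eqP sz).
have is_ : (i < size (sort ge (codom f)))%N by rewrite (eqP sz).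
rewrite ltn_neqAle (inj_eq val_inj) nth_uniq // gtn_eqF //=.
apply: (sorted_leq_nth _ _ _ ss) => //; last exact: ltnW.
  by move=> a b c /= h1 h2; apply: leq_trans h1.
by move=> a; exact: leqnn.
Qed.

(** Expanding the product gives a sum over all maps [f]. A map that is not injective repeats a row
    of [B] and contributes 0; an injective one is uniquely a decreasing map composed with a
    permutation, and the permutations reassemble the minor of [A]. *)
Lemma det_cauchy_binet (A : 'M[R]_(n, N)) (B : 'M[R]_(N, n)) :
  \det (A *m B) = \sum_(f : {ffun 'I_n -> 'I_N} | sdecr f)
    \det (colsub f A) * \det (rowsub f B).
Proof.
pose F (f : {ffun 'I_n -> 'I_N}) := (\prod_i A i (f i)) * \det (rowsub f B).
transitivity (\sum_(f : {ffun 'I_n -> 'I_N}) F f).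
  rewrite /determinant.
  under eq_bigr => s _.
    under eq_bigr do rewrite mxE.
    rewrite bigA_distr_bigA big_distrr /=.
    over.
  rewrite exchange_big /=; apply: eq_bigr => f _; rewrite /F big_distrr /=.
  apply: eq_bigr => s _; rewrite big_split /= mulrCA; congr (_ * (_ * _)).
  by apply: eq_bigr => i _; rewrite mxE.
transitivity (\sum_(f : {ffun 'I_n -> 'I_N} | injectiveb f) F f).
  rewrite (bigID (fun f : {ffun 'I_n -> 'I_N} => injectiveb f)) /=.
  rewrite [X in _ + X]big1 ?addr0 // => f /injectivePn[i [j ij e]].
  rewrite /F [\det _](determinant_alternate ij) ?mulr0 // => k.
  by rewrite !mxE e.
transitivity (\sum_(p : {ffun 'I_n -> 'I_N} * 'S_n | sdecr p.1)
    F [ffun i => p.1 (p.2 i)]).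
  rewrite [RHS](partition_big
    (fun p : {ffun 'I_n -> 'I_N} * 'S_n => [ffun i => p.1 (p.2 i)])
    (fun f : {ffun 'I_n -> 'I_N} => injectiveb f)) /=; last first.
    move=> [d s] /= dd; apply/injectiveP=> i j; rewrite !ffunE.
    by move=> /(sdecr_inj dd) /perm_inj.
  apply: eq_bigr => f /injectiveP /inj_sdecr_perm[d dd [s es]].
  rewrite (eq_bigr (fun=> F f)); last by move=> p /andP[_ /eqP ->].
  rewrite (big_pred1 (d, s)) // => -[d' s'] /=.
  rewrite xpair_eqE; apply/andP/andP=> [[dd' /eqP]|[/eqP -> /eqP ->]]; last first.
    by split=> //; rewrite es.
  rewrite es => /ffunP e.
  have dE : d' = d.
    apply: sdecr_codom_eq => // a; apply/codomP/codomP=> -[i ->].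
      by exists (s ((s'^-1)%g i)); have := e ((s'^-1)%g i); rewrite !ffunE permKV.
    by exists (s' ((s^-1)%g i)); have := e ((s^-1)%g i); rewrite !ffunE permKV.
  split; first by rewrite dE.
  apply/eqP/permP=> i; have := e i; rewrite !ffunE dE.
  by move=> /(sdecr_inj dd).
rewrite (eq_bigl (fun p => sdecr p.1 && true)) => [|p]; last by rewrite andbT.
rewrite -(pair_big (fun d : {ffun 'I_n -> 'I_N} => sdecr d) xpredT
  (fun d (s : 'S_n) => F [ffun i => d (s i)])) /=.
apply: eq_bigr => d dd; rewrite {1}/determinant big_distrl /=.
apply: eq_bigr => s _; rewrite /F.
have -> : rowsub [ffun i => d (s i)] B = row_perm s (rowsub d B).
  by apply/matrixP=> i j; rewrite !mxE ffunE.
rewrite row_permE det_mulmx det_perm mulrCA mulrA; congr (_ * _ * _).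
by apply: eq_bigr => i _; rewrite mxE ffunE.
Qed.
End CauchyBinet.

(** Terms vanish unless t <= a <= s, and the two hypotheses put this interval inside the range of
    summation. *)
Lemma pcoef_conv (R : comNzRingType) (f g : nat -> R) (N : nat) (s t : int) :
  (s < N%:Z)%R -> (0 <= t)%R ->
  \sum_(a < N) pcoef f (s - a%:Z) * pcoef g (a%:Z - t) = pcoef (ps_mul f g) (s - t).
Proof.
move=> sN; case: t => // t _.
have [st|] := boolP (s < t%:Z)%R.
  rewrite [RHS]pcoef_lt0 ?big1 //; last by lia.
  move=> a _; have [h|h] := boolP (s < a%:Z)%R.
    by rewrite pcoef_lt0 ?mul0r //; lia.
  by rewrite [X in _ * X]pcoef_lt0 ?mulr0 //; lia.
case: s sN => // s sN; rewrite -leNgt lez_nat => ts; rewrite ltz_nat in sN.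
rewrite -(big_mkord xpredT (fun a => pcoef f (s%:Z - a%:Z) * pcoef g (a%:Z - t%:Z))).
rewrite (@big_cat_nat _ _ _ t) ?(leq_trans ts (ltnW sN)) //=.
rewrite big_nat_cond big1 ?add0r; last first.
  by move=> a /andP[/andP[_ h] _]; rewrite [X in _ * X]pcoef_lt0 ?mulr0 //; lia.
rewrite (@big_cat_nat _ _ _ s.+1) ?(leqW ts) //=.
rewrite [X in _ + X]big_nat_cond [X in _ + X]big1 ?addr0; last first.
  by move=> a /andP[/andP[h _] _]; rewrite pcoef_lt0 ?mul0r //; lia.
have -> : s%:Z - t%:Z = (s - t)%N%:Z by lia.
rewrite /= ps_mulC /ps_mul -{1}[t]add0n big_addn subSn // big_mkord.
apply: eq_bigr => i _; rewrite mulrC.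
have -> : (i + t)%N%:Z - t%:Z = i%:Z by lia.
by have -> : s%:Z - (i + t)%N%:Z = (s - t - i)%N%:Z by have := ltn_ord i; lia.
Qed.

(** * Transfer matrices *)

Section Box.
Variables (b n : nat).

(* The partition nu with parts at most b is encoded by the strictly decreasing *)
(* sequence i |-> nu i + (n - 1 - i), which indexes the minors in the Cauchy-  *)
(* Binet formula.                                                              *)
Definition boxpart : finType := {f : {ffun 'I_n -> 'I_(b + n)} | sdecr f}.

Lemma sdecr_gap (f : {ffun 'I_n -> 'I_(b + n)}) (i j : 'I_n) :
  sdecr f -> (i <= j)%N -> (f j + (j - i) <= f i)%N.
Proof.
move=> /sdecrP fd; case: j => j jn /=; elim: j jn => [|j IH] jn ij.
  have -> : i = Ordinal jn by apply: val_inj => /=; lia.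
  by rewrite /= subnn addn0.
case: (ltngtP i j.+1) ij => // [ij _|e _]; last first.
  by have -> : i = Ordinal jn; [exact: val_inj|rewrite /= subnn addn0].
have := IH (ltnW jn) ij; have := fd (Ordinal (ltnW jn)) (Ordinal jn) (ltnSn j).
lia.
Qed.

Definition boxpart_tuple (f : boxpart) : n.-tuple nat :=
  [tuple (val f i - (n.-1 - i))%N | i < n].

(** Hence the truncated subtraction in [boxpart_tuple] loses nothing. *)
Lemma boxpart_lb (f : boxpart) (i : 'I_n) : (n.-1 - i <= val f i)%N.
Proof.
have jn : (n.-1 < n)%N by case: (n) i => [[]|].
have /= := @sdecr_gap (val f) i (Ordinal jn) (valP f); have := ltn_ord i; lia.
Qed.

Lemma boxpart_sorted (f : boxpart) : sorted geq (boxpart_tuple f).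
Proof.
apply/(sortedP 0%N) => i; rewrite size_tuple => i1n.
have i0n := ltnW i1n; rewrite -[i]/(nat_of_ord (Ordinal i0n)).
rewrite -[(Ordinal i0n).+1]/(nat_of_ord (Ordinal i1n)) -!tnth_nth !tnth_mktuple.
have /= := sdecrP _ (valP f) (Ordinal i0n) (Ordinal i1n) (ltnSn i); lia.
Qed.

Definition bpart (f : boxpart) : intpart n := IntPart (boxpart_sorted f).

Lemma bpartE (f : boxpart) (i : 'I_n) : pt (bpart f) i = (val f i - (n.-1 - i))%N.
Proof. by rewrite /pt -tnth_nth tnth_mktuple. Qed.

Lemma val_boxpart (f : boxpart) (i : 'I_n) :
  (val f i = pt (bpart f) i + (n.-1 - i) :> nat)%N.
Proof. by rewrite bpartE subnK // boxpart_lb. Qed.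

Lemma bpart_inj : injective bpart.
Proof.
move=> f g e; apply/val_inj/ffunP=> i; apply: val_inj => /=.
by rewrite !val_boxpart e.
Qed.

Lemma bpart_le f i : (pt (bpart f) i <= b)%N.
Proof.
case: (ltnP i n) => ni; last by rewrite /pt nth_default // size_tuple.
have n0 : (0 < n)%N by apply: leq_ltn_trans ni.
apply: leq_trans (pt_anti _ (leq0n i)) _; rewrite (bpartE f (Ordinal n0)).
have := ltn_ord (val f (Ordinal n0)); rewrite /=; lia.
Qed.

Lemma bpart_surj nu : (forall i, pt nu i <= b)%N -> exists f, bpart f = nu.
Proof.
move=> nub.
have lt (i : 'I_n) : (pt nu i + (n.-1 - i) < b + n)%N.
  by have := nub i; have := ltn_ord i; lia.
have dec : sdecr [ffun i => Ordinal (lt i)].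
  apply/sdecrP=> i j ij; rewrite !ffunE /=.
  have := pt_anti nu (ltnW ij); have := ltn_ord j; lia.
exists (Sub _ dec : boxpart); apply: intpart_eqP => i ni.
by rewrite (bpartE _ (Ordinal ni)) /= ffunE /= addnK.
Qed.

Lemma sum_boxpart (R : nmodType) (F : {ffun 'I_n -> 'I_(b + n)} -> R) :
  \sum_(f | sdecr f) F f = \sum_(f : boxpart) F (val f).
Proof.
rewrite (reindex_omap (val : boxpart -> _) insub) => [|f fd].
  by apply: eq_bigl => f /=; rewrite (valP f) valK eqxx.
by rewrite insubT.
Qed.

Section Matrices.
Variable R : comNzRingType.
Implicit Types F G : intpart n -> intpart n -> R.

Definition bmx F : 'M[R]_#|{: boxpart}| :=
  \matrix_(i, j) F (bpart (enum_val i)) (bpart (enum_val j)).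

Lemma bmxM F G : bmx F *m bmx G =
  bmx (fun lam mu => \sum_(k : boxpart) F lam (bpart k) * G (bpart k) mu).
Proof.
apply/matrixP=> i j; rewrite !mxE [RHS](reindex _ (onW_bij _ (@enum_val_bij boxpart))) /=.
by apply: eq_bigr => k _; rewrite !mxE.
Qed.

Lemma eq_bmx F G : (forall f g, F (bpart f) (bpart g) = G (bpart f) (bpart g)) ->
  bmx F = bmx G.
Proof. by move=> FG; apply/matrixP=> i j; rewrite !mxE. Qed.

Lemma bmx_inj F G f g : bmx F = bmx G ->
  F (bpart f) (bpart g) = G (bpart f) (bpart g).
Proof.
move=> /matrixP /(_ (enum_rank f) (enum_rank g)).
by rewrite !mxE !enum_rankK.
Qed.

Lemma bmx1 : bmx (fun lam mu => (lam == mu)%:R) = 1%:M.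
Proof.
by apply/matrixP=> i j; rewrite !mxE (inj_eq bpart_inj) (inj_eq enum_val_inj).
Qed.
End Matrices.
End Box.

Lemma gone0 (R : comNzRingType) (alpha beta : nat -> R) n (lam mu : intpart n) :
  gone alpha beta 0 lam mu = (lam == mu)%:R.
Proof.
rewrite /gone; case: ifPn => [ml|nml]; last first.
  by case: eqP nml => // ->; rewrite subpart_refl.
have [<-|ne] := eqVneq lam mu.
  by rewrite big1 // => i _; rewrite big_geq.
have ex : exists i, (pt mu i < pt lam i)%N.
  have /existsP[i] : [exists i : 'I_n, (pt mu i < pt lam i)%N].
    apply: contraNT ne; rewrite negb_exists => /forallP h; apply/eqP.
    apply: subpart_anti => //; apply/forallP=> i; rewrite !partE leqNgt; exact: h.
  by exists i.
move/subpartP: ml => ml.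
(* In the first nonempty row the last cell has neither a right neighbour nor a cell above, so its
   weight is x = 0. *)
case: (ex_minnP ex) => i lti imin.
have ni : (i < n)%N.
  by case: (ltnP i n) lti => // ni; rewrite /pt !nth_default ?size_tuple.
rewrite big_mkord (bigD1 (Ordinal ni)) //=.
have [c ec] : exists c, pt lam i = c.+1.
  by exists (pt lam i).-1; rewrite prednK // (leq_trans _ lti).
rewrite ec big_nat_recr /=; last by rewrite -ltnS -ec.
rewrite /gcell ec ltnn add0r.
suff -> : (0 < i)%N && (pt mu i.-1 <= c)%N = false by rewrite mulr0 mul0r.
apply/negbTE; rewrite negb_and -ltnNge; case: i => [//|i] /= in lti imin ni ec *.
have : ~~ (pt mu i < pt lam i)%N.
  by apply/negP => /imin; rewrite ltnn.
by rewrite -leqNgt -ltnNge => h; apply: leq_trans _ h; rewrite -ec pt_anti.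
Qed.

(** * The factorization G(x) = C S(x) C' and its products *)

Section Transfer.
Variables (R : comNzRingType) (alpha beta : nat -> R) (b n : nat).
Implicit Types lam mu : intpart n.
Local Notation bp := (boxpart b n).
Local Notation zero := (fun=> 0 : R).

Lemma hgen_zero Z : hgen zero zero Z = @ps_one R.
Proof.
rewrite /Defs.hgen big1 // => u _.
have -> : Defs.pval zero zero u = 0 by case: u.
have g0 : ps_geom 0 = @ps_one R.
  by apply/funext=> m; rewrite /ps_geom /ps_one expr0n.
have l0 : ps_lin 0 = @ps_one R.
  by apply/funext=> m; rewrite /ps_lin /ps_one scale0r subr0 coef1.
elim/int_rect: (Z@_u) => [|k E|k E] //.
  by rewrite -addn1 PoszD ps_linXS E g0 ps_mul1f.
by rewrite -addn1 PoszD opprD ps_linXB E l0 ps_mul1f.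
Qed.

(** Each entry is a coefficient of a product of three series. The shift by n - 1 makes the inner
    indices nonnegative, and the bound on [lam] keeps them below b + n, so [pcoef_conv] applies
    twice. *)
Lemma xmx_factor x lam mu : (forall i, pt lam i <= b)%N ->
  xmx alpha beta x lam mu =
  (\matrix_(i < n, a < b + n) pcoef (hgen alpha beta (zrow lam i))
     ((lam i)%:Z - i%:Z + n%:Z - 1 - a%:Z)) *m
  ((\matrix_(a < b + n, c < b + n) pcoef (ps_geom x) (a%:Z - c%:Z)) *m
   (\matrix_(c < b + n, j < n) pcoef (hgen alpha beta (zcol mu j))
     (c%:Z - ((mu j)%:Z - j%:Z + n%:Z - 1)))).
Proof.
move=> lamb; apply/matrixP=> i j; rewrite !mxE.
have hi := ltn_ord i; have hj := ltn_ord j.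
under eq_bigr => a _.
  rewrite !mxE; under eq_bigr do rewrite !mxE.
  rewrite pcoef_conv; [|by have := ltn_ord a; lia|by lia].
  over.
have li := lamb i; rewrite -partE in li.
rewrite pcoef_conv; [|by lia|by lia].
rewrite hgenD; congr pcoef; last by lia.
by rewrite [RHS]ps_mulCA.
Qed.

(** The minors in Cauchy-Binet are indexed by nu_j + n - 1 - j, so the shifts by n - 1 cancel and
    leave the indices of [cdet] and [cdet']. The middle minor is [det_xmx] at zero parameters. *)
Lemma gone_factor x lam mu : (forall i, pt lam i <= b)%N ->
  gone alpha beta x lam mu = \sum_(nu : bp) \sum_(rho : bp)
    cdet alpha beta lam (bpart nu) * gone zero zero x (bpart nu) (bpart rho) *
    cdet' alpha beta (bpart rho) mu.
Proof.
move=> lamb; rewrite -det_xmx xmx_factor // det_cauchy_binet.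
rewrite sum_boxpart; apply: eq_bigr => nu _.
rewrite -mul_rowsub_mx det_cauchy_binet sum_boxpart big_distrr.
apply: eq_bigr => rho _; rewrite /= mulrA; congr (_ * _ * _).
- congr (\det _); apply/matrixP=> i j; rewrite !mxE partE val_boxpart.
  have hi := ltn_ord i; have hj := ltn_ord j.
  by congr pcoef; [rewrite /zrow partE|rewrite partE; lia].
- rewrite -det_xmx; congr (\det _); apply/matrixP=> i j; rewrite !mxE.
  rewrite hgen_zero ps_mulf1 !partE !val_boxpart.
  by have hi := ltn_ord i; have hj := ltn_ord j; congr pcoef; lia.
congr (\det _); apply/matrixP=> i j; rewrite !mxE !partE val_boxpart.
have hi := ltn_ord i; have hj := ltn_ord j.
by congr pcoef; [rewrite /zcol partE|lia].
Qed.

(** An entry of the product of the matrices G(x) in the order of [xs]. The parameters are arguments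
    so that zero gives the Schur side. *)
Fixpoint gpath (al be : nat -> R) (xs : seq R) lam mu : R :=
  if xs is x :: xs' then
    \sum_(k : bp) gone al be x lam (bpart k) * gpath al be xs' (bpart k) mu
  else (lam == mu)%:R.

Lemma gpath_factor xs (f g : bp) :
  gpath alpha beta xs (bpart f) (bpart g) = \sum_(nu : bp) \sum_(rho : bp)
    cdet alpha beta (bpart f) (bpart nu) * gpath zero zero xs (bpart nu) (bpart rho) *
    cdet' alpha beta (bpart rho) (bpart g).
Proof.
pose C := bmx b (@cdet R alpha beta n); pose C' := bmx b (@cdet' R alpha beta n).
have prodE (F : intpart n -> intpart n -> R) : C *m bmx b F *m C' =
    bmx b (fun lam mu => \sum_(nu : bp) \sum_(rho : bp)
      cdet alpha beta lam (bpart nu) * F (bpart nu) (bpart rho) *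
      cdet' alpha beta (bpart rho) mu).
  rewrite -mulmxA /C /C' !bmxM; apply: eq_bmx => f' g'; apply: eq_bigr => nu _.
  by rewrite big_distrr; apply: eq_bigr => rho _; rewrite /= mulrA.
have G1 x : bmx b (gone alpha beta x) = C *m bmx b (gone zero zero x) *m C'.
  by rewrite prodE; apply: eq_bmx => f' g'; apply: gone_factor => i; exact: bpart_le.
(* Specialize G(x) = C S(x) C' to x = 0, where both G and S are the identity. *)
have CC' : C *m C' = 1%:M.
  have := G1 0; rewrite (eq_bmx (G := fun lam mu => (lam == mu)%:R)); last first.
    by move=> f' g'; exact: gone0.
  rewrite bmx1 [X in _ = C *m X *m _](_ : _ = 1%:M) ?mulmx1 //.
  by rewrite -bmx1; apply: eq_bmx => f' g'; exact: gone0.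
have C'C := mulmx1C CC'.
apply: (bmx_inj (G := fun lam mu => \sum_(nu : bp) \sum_(rho : bp)
      cdet alpha beta lam (bpart nu) * gpath zero zero xs (bpart nu) (bpart rho) *
      cdet' alpha beta (bpart rho) mu)).
rewrite -prodE; elim: xs => [|x xs IH].
  by rewrite /= bmx1 mulmx1 CC'.
rewrite -[bmx _ (gpath _ _ (x :: xs))]bmxM -[bmx _ (gpath zero _ _)]bmxM.
by rewrite IH G1 !mulmxA -[_ *m C' *m C]mulmxA C'C mulmx1.
Qed.
End Transfer.

(** * Branching *)

Section Shape.
Variable n : nat.
Implicit Types lam mu nu : intpart n.

Definition in_shape lam mu (i j : nat) := (pt mu i <= j < pt lam i)%N.

Lemma in_shape_ltn lam mu i j : in_shape lam mu i j -> (i < n)%N.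
Proof.
rewrite /in_shape; case: (ltnP i n) => // ni.
by rewrite [pt lam i]nth_default ?size_tuple // andbF.
Qed.

Lemma part_le_max lam i : (pt lam i <= \max_i lam i)%N.
Proof.
case: (ltnP i n) => ni; last by rewrite /pt nth_default ?size_tuple.
by rewrite -(partE lam (Ordinal ni)); exact: leq_bigmax.
Qed.

Definition row_of lam mu (c : cell lam mu) : nat := (val c).1.
Definition col_of lam mu (c : cell lam mu) : nat := (val c).2.

Lemma cell_in_shape lam mu (c : cell lam mu) :
  in_shape lam mu (row_of c) (col_of c).
Proof. by have := valP c; rewrite /= !partE. Qed.

Lemma cell_eqP lam mu (c d : cell lam mu) :
  row_of c = row_of d -> col_of c = col_of d -> c = d.
Proof.
move=> h1 h2; apply: val_inj; apply: injective_projections; exact: val_inj.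
Qed.

Lemma in_shapeP lam mu i j : in_shape lam mu i j ->
  exists2 c : cell lam mu, row_of c = i & col_of c = j.
Proof.
move=> s; have ni := in_shape_ltn s.
have jm : (j < \max_i lam i)%N.
  by case/andP: s => _ /leq_trans; apply; exact: part_le_max.
have p : (mu (Ordinal ni) <= Ordinal jm < lam (Ordinal ni))%N by rewrite !partE.
by exists (Sub (Ordinal ni, Ordinal jm) p).
Qed.

Lemma prod_cell (R : comNzRingType) lam mu (F : nat -> nat -> R) :
  \prod_(c : cell lam mu) F (row_of c) (col_of c) =
  \prod_(0 <= i < n) \prod_(pt mu i <= j < pt lam i) F i j.
Proof.
pose P (c : box lam) := (mu c.1 <= c.2 < lam c.1)%N.
transitivity (\prod_(c : box lam | P c) F c.1 c.2).
  rewrite (reindex_omap (val : cell lam mu -> box lam) insub) => [|c Pc].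
    by apply: eq_bigl => c /=; rewrite /P (valP c) valK eqxx.
  by rewrite insubT.
rewrite -(pair_big_dep xpredT (fun i j => P (i, j)) (fun i j => F i j)) /=.
rewrite big_mkord; apply: eq_bigr => i _.
rewrite [RHS](big_nat_widenl _ 0) // (big_nat_widen _ _ _ _ _ (part_le_max lam i)).
by rewrite big_mkord; apply: eq_bigl => j; rewrite /P /= !partE.
Qed.

(** Fillings become functions of two integers, so that fillings of different shapes can be compared;
    the value 0 off the shape is a dummy. *)
Definition extend lam mu (T : {ffun cell lam mu -> nat}) (i j : nat) : nat :=
  if [pick c : cell lam mu | (row_of c == i) && (col_of c == j)] is Some c
  then T c else 0%N.

Lemma extendE lam mu (T : {ffun cell lam mu -> nat}) c :
  extend T (row_of c) (col_of c) = T c.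
Proof.
rewrite /extend; case: pickP => [d /andP[/eqP h1 /eqP h2]|/(_ c)].
  by congr (T _); exact: cell_eqP.
by rewrite !eqxx.
Qed.

Definition rpp lam mu (t : nat -> nat -> nat) : Prop :=
  [/\ forall i j, in_shape lam mu i j -> (0 < t i j)%N,
      forall i j k, in_shape lam mu i j -> in_shape lam mu i k -> (j < k)%N ->
        (t i j <= t i k)%N &
      forall i k j, in_shape lam mu i j -> in_shape lam mu k j -> (i < k)%N ->
        (t i j <= t k j)%N].

Lemma eq_rpp lam mu t t' : (forall i j, in_shape lam mu i j -> t i j = t' i j) ->
  rpp lam mu t -> rpp lam mu t'.
Proof.
move=> e [h1 h2 h3]; split.
- by move=> i j s; rewrite -e // h1.
- by move=> i j k s s' jk; rewrite -!e // h2.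
by move=> i j k s s' jk; rewrite -!e // h3.
Qed.

Lemma is_rppP lam mu (T : filling lam mu) : reflect (rpp lam mu (extend T)) (is_rpp T).
Proof.
apply: (iffP and3P) => [[/forallP h1 /forallP h2 /forallP h3]|[h1 h2 h3]]; split.
- by move=> i j /in_shapeP[c <- <-]; rewrite extendE h1.
- move=> i j k /in_shapeP[c <- <-] /in_shapeP[d rd <-]; rewrite -{2}rd !extendE => lt.
  move/forallP/(_ d)/implyP: (h2 c); apply; rewrite /crow /ccol eqSS ltnS lt andbT.
  by apply/eqP; rewrite -[LHS]/(row_of c) -rd.
- move=> i k j /in_shapeP[c <- <-] /in_shapeP[d <- cd]; rewrite -{2}cd !extendE => lt.
  move/forallP/(_ d)/implyP: (h3 c); apply; rewrite /crow /ccol eqSS ltnS lt andbT.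
  by apply/eqP; rewrite -[LHS]/(col_of c) -cd.
- by apply/forallP=> c; rewrite -extendE h1 // cell_in_shape.
- apply/forallP=> c; apply/forallP=> d; apply/implyP.
  rewrite /crow /ccol eqSS ltnS => /andP[/eqP r lt].
  have {}r : row_of c = row_of d by [].
  rewrite -!extendE r; apply: h2; rewrite ?cell_in_shape //.
  by rewrite -r cell_in_shape.
apply/forallP=> c; apply/forallP=> d; apply/implyP.
rewrite /crow /ccol eqSS ltnS => /andP[/eqP r lt].
have {}r : col_of c = col_of d by [].
rewrite -!extendE r; apply: h3; rewrite ?cell_in_shape //.
by rewrite -r cell_in_shape.
Qed.

Lemma right_exists lam mu (T : filling lam mu) (c : cell lam mu) :
  [exists d, is_right c d && (T c == T d)] =
  ((col_of c).+1 < pt lam (row_of c))%N &&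
    (extend T (row_of c) (col_of c) == extend T (row_of c) (col_of c).+1).
Proof.
apply/existsP/andP => [[d /andP[/andP[/eqP e1 /eqP e2] e]]|[lt e]].
  have r : row_of d = row_of c by case: e1.
  have k : col_of d = (col_of c).+1 by case: e2.
  by rewrite -k -{3}r !extendE -r; case/andP: (cell_in_shape d).
have /in_shapeP[d r k] : in_shape lam mu (row_of c) (col_of c).+1.
  by rewrite /in_shape lt andbT; apply: leqW; case/andP: (cell_in_shape c).
exists d; rewrite -k -{2}r !extendE in e; rewrite e andbT /is_right /crow /ccol.
by rewrite -[nat_of_ord _]/(row_of d) -[X in _ && (X.+1 == _)]/(col_of d) r k !eqxx.
Qed.

Lemma above_exists lam mu (T : filling lam mu) (c : cell lam mu) :
  [exists d, is_above c d && (T d == T c)] =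
  [&& (0 < row_of c)%N, (pt mu (row_of c).-1 <= col_of c)%N &
    (extend T (row_of c).-1 (col_of c) == extend T (row_of c) (col_of c))].
Proof.
apply/existsP/and3P => [[d /andP[/andP[/eqP e1 /eqP e2] e]]|[r0 lt e]].
  have r : (row_of d).+1 = row_of c by case: e1.
  have k : col_of d = col_of c by case: e2.
  have dE : T d = extend T (row_of c).-1 (col_of c) by rewrite -extendE k -r.
  rewrite extendE -dE e -r; split=> //=.
  by rewrite -k; case/andP: (cell_in_shape d).
have /in_shapeP[d r k] : in_shape lam mu (row_of c).-1 (col_of c).
  rewrite /in_shape lt /=; have /andP[_ h] := cell_in_shape c.
  by apply: leq_trans h (pt_anti _ _); exact: leq_pred.
exists d; rewrite -r -{1}k !extendE in e; rewrite e andbT /is_above /crow /ccol.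
rewrite -[nat_of_ord _]/(row_of d) -[X in _ && (X.+1 == _)]/(col_of d) k r.
by rewrite prednK // !eqxx.
Qed.
End Shape.

Section Branching.
Variables (R : comNzRingType) (alpha beta X : nat -> R) (n : nat).
Implicit Types (lam mu nu : intpart n) (t : nat -> nat -> nat) (K : nat).

(** The marked and unmarked weights of one cell added together, as the marks of different cells are
    independent. *)
Definition wt_at lam mu t (i j : nat) : R :=
  (if (j.+1 < pt lam i)%N && (t i j == t i j.+1) then - alpha j.+1 else 0) +
  (if [&& (0 < i)%N, (pt mu i.-1 <= j)%N & t i.-1 j == t i j] then beta i
   else X (t i j)).

Definition wt_shape lam mu t : R :=
  \prod_(0 <= i < n) \prod_(pt mu i <= j < pt lam i) wt_at lam mu t i j.

(** Entries at most [K] form a finite type; the entry 0 is excluded later by [rpp]. *)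
Definition bfill K lam mu : finType := {ffun cell lam mu -> 'I_K.+1}.

Definition fill_of K lam mu (T : bfill K lam mu) : filling lam mu :=
  [ffun c => val (T c)].

Definition bext K lam mu (T : bfill K lam mu) := extend (fill_of T).

Definition brestr K lam mu t : bfill K lam mu :=
  [ffun c => inord (t (row_of c) (col_of c))].

Lemma bext_restr K lam mu t i j : in_shape lam mu i j -> (t i j <= K)%N ->
  bext (brestr K lam mu t) i j = t i j.
Proof.
move=> /in_shapeP[c <- <-] tK; rewrite /bext extendE !ffunE /=.
by rewrite inordK.
Qed.

Lemma bext_le K lam mu (T : bfill K lam mu) i j :
  in_shape lam mu i j -> (bext T i j <= K)%N.
Proof.
by move=> /in_shapeP[c <- <-]; rewrite /bext extendE ffunE /= -ltnS.
Qed.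

Lemma bfill_eqP K lam mu (T U : bfill K lam mu) :
  (forall i j, in_shape lam mu i j -> bext T i j = bext U i j) -> T = U.
Proof.
move=> e; apply/ffunP=> c; apply: val_inj => /=.
have := e _ _ (cell_in_shape c).
by rewrite /bext !extendE !ffunE.
Qed.

Definition gsum K lam mu : R :=
  if subpart mu lam then
    \sum_(T : bfill K lam mu | `[< rpp lam mu (bext T) >]) wt_shape lam mu (bext T)
  else 0.

Definition glue K nu t (i j : nat) : nat := if (j < pt nu i)%N then t i j else K.+1.

Definition splits K lam mu nu t : Prop :=
  forall i j, in_shape lam mu i j -> (t i j <= K)%N = (j < pt nu i)%N.

(** Neighbours on opposite sides of the boundary of [nu] have different entries, so they do not
    affect each other's weights; outside [nu] all entries equal K+1, which is the one-letter
    situation. *)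
Lemma wt_shape_glue K lam mu nu t t' : subpart mu nu -> subpart nu lam ->
  (forall i j, in_shape lam mu i j -> t i j = glue K nu t' i j) ->
  (forall i j, in_shape nu mu i j -> (t' i j <= K)%N) ->
  wt_shape lam mu t = gone alpha beta (X K.+1) lam nu * wt_shape nu mu t'.
Proof.
move=> /subpartP mn snl tE t'K; rewrite /gone snl; move/subpartP: snl => nl.
rewrite mulrC -big_split; apply: eq_bigr => i _ /=.
rewrite (@big_cat_nat _ _ _ (pt nu i)) //=; congr (_ * _).
  apply: eq_big_nat => j /andP[mj jn].
  have jl := leq_trans jn (nl i).
  have sij : in_shape nu mu i j by rewrite /in_shape mj jn.
  have tij : t i j = t' i j by rewrite tE ?/in_shape ?mj ?jl // /glue jn.
  rewrite /wt_at tij; congr (_ + _).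
    congr (if _ then _ else _); have [j1l|j1l] := ltnP j.+1 (pt lam i); last first.
      by have /negbTE -> : ~~ (j.+1 < pt nu i)%N by rewrite -leqNgt (leq_trans _ j1l).
    rewrite tE ?/in_shape ?(leqW mj) ?j1l // /glue; case: ifP => //= _.
    by apply/negbTE; rewrite neq_ltn ltnS t'K.
  congr (if _ then _ else _).
  case: (posnP i) => //= i0; case: (leqP (pt mu i.-1) j) => //= mj'.
  have jn' : (j < pt nu i.-1)%N by apply: leq_trans jn (pt_anti _ (leq_pred _)).
  by rewrite tE ?/in_shape ?mj' ?(leq_trans jn' (nl _)) // /glue jn'.
apply: eq_big_nat => j /andP[nj jl].
have mj := leq_trans (mn i) nj.
have tij : t i j = K.+1 by rewrite tE ?/in_shape ?mj ?jl // /glue ltnNge nj.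
rewrite /wt_at /gcell tij; congr (_ + _).
  have [j1l|//] := ltnP j.+1 (pt lam i).
  rewrite tE ?/in_shape ?(leqW mj) ?j1l // /glue.
  by rewrite ltnNge (leqW nj) eqxx.
congr (if _ then _ else _).
case: (posnP i) => //= i0.
have jl' : (j < pt lam i.-1)%N by apply: leq_trans jl (pt_anti _ (leq_pred _)).
have [nj'|jn'] := leqP (pt nu i.-1) j.
  have mj' := leq_trans (mn i.-1) nj'; rewrite mj' /=.
  by rewrite tE ?/in_shape ?mj' ?jl' // /glue ltnNge nj' eqxx.
case: leqP => //= mj'.
rewrite tE ?/in_shape ?mj' ?jl' // /glue jn'.
by apply/negbTE; rewrite neq_ltn ltnS t'K // /in_shape mj' jn'.
Qed.

Lemma splits_inj K lam mu nu nu' t :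
  subpart mu nu -> subpart nu lam -> subpart mu nu' -> subpart nu' lam ->
  splits K lam mu nu t -> splits K lam mu nu' t -> nu = nu'.
Proof.
move=> /subpartP mn /subpartP nl /subpartP mn' /subpartP nl' s s'.
apply: intpart_eqP => i _.
case: (ltngtP (pt nu i) (pt nu' i)) => // lt.
  have sh : in_shape lam mu i (pt nu i) by rewrite /in_shape mn (leq_trans lt).
  by have := s _ _ sh; rewrite s' // lt ltnn.
have sh : in_shape lam mu i (pt nu' i) by rewrite /in_shape mn' (leq_trans lt).
by have := s' _ _ sh; rewrite s // lt ltnn.
Qed.

Lemma splits_exists K lam mu t : subpart mu lam -> rpp lam mu t ->
  exists nu, [/\ subpart mu nu, subpart nu lam & splits K lam mu nu t].
Proof.
move=> /subpartP ml [_ rt ct].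
(* Row [i] of nu ends at the first column holding an entry above [K], or at the end of the row of
   [lam] if there is none. Weakly increasing columns make these lengths decrease with [i]. *)
pose p i j := (pt mu i <= j)%N && ~~ (t i j <= K)%N.
pose k i := find (p i) (iota 0 (pt lam i)).
have kl i : (k i <= pt lam i)%N by rewrite -[X in (_ <= X)%N](size_iota 0) find_size.
have kp i : (k i < pt lam i)%N -> p i (k i).
  move=> lt; have := nth_find 0%N (a := p i) (s := iota 0 (pt lam i)).
  by rewrite has_find size_iota -/(k i) lt nth_iota // => /(_ isT).
have kn i j : (j < k i)%N -> ~~ p i j.
  move=> lt; have := before_find 0%N lt; rewrite nth_iota ?(leq_trans lt) // => ->.
  by [].
have mk i : (pt mu i <= k i)%N.
  by case: (ltnP (k i) (pt lam i)) => [/kp/andP[]//|]; apply: leq_trans.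
have sp i j : in_shape lam mu i j -> (t i j <= K)%N = (j < k i)%N.
  move=> /andP[mj jl]; have [/kn|kj] := ltnP j (k i).
    by rewrite /p mj negbK.
  have klt := leq_ltn_trans kj jl; have /andP[mki ntk] := kp _ klt.
  apply/negbTE; rewrite -ltnNge; rewrite -ltnNge in ntk.
  move: kj; rewrite leq_eqVlt => /orP[/eqP <- //|kj].
  by apply: leq_trans ntk (rt _ _ _ _ _ kj); rewrite /in_shape ?mki ?klt ?mj.
have ka i : (k i.+1 <= k i)%N.
  rewrite leqNgt; apply/negP => lt.
  have l1 : (k i < pt lam i.+1)%N by apply: leq_trans (kl _).
  have l2 : (k i < pt lam i)%N by apply: leq_trans l1 (pt_anti _ (leqnSn i)).
  have s1 : in_shape lam mu i.+1 (k i).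
    by rewrite /in_shape l1 andbT (leq_trans _ (mk i)) // pt_anti.
  have s2 : in_shape lam mu i (k i) by rewrite /in_shape l2 mk.
  have := sp _ _ s1; rewrite lt => h.
  have := sp _ _ s2; rewrite ltnn => /negbT/negP; apply.
  exact: leq_trans (ct _ _ _ s2 s1 (ltnSn i)) h.
have srt : sorted geq [tuple k i | i < n].
  apply/(sortedP 0%N) => i; rewrite size_tuple => i1n; have i0n := ltnW i1n.
  rewrite -[i]/(nat_of_ord (Ordinal i0n)) -[(Ordinal i0n).+1]/(nat_of_ord (Ordinal i1n)).
  by rewrite -!tnth_nth !tnth_mktuple; exact: ka.
pose nu := IntPart srt.
have nuE i : (i < n)%N -> pt nu i = k i.
  by move=> ni; rewrite /pt -[i]/(nat_of_ord (Ordinal ni)) -tnth_nth tnth_mktuple.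
exists nu; split.
- by apply/forallP=> i; rewrite !partE nuE.
- by apply/forallP=> i; rewrite !partE nuE.
by move=> i j s; rewrite nuE ?sp // (in_shape_ltn s).
Qed.

Lemma rpp_glue K lam mu nu t : subpart mu nu -> subpart nu lam ->
  (forall i j, in_shape nu mu i j -> (t i j <= K)%N) ->
  rpp nu mu t <-> rpp lam mu (glue K nu t).
Proof.
move=> /subpartP mn /subpartP nl tK.
have sub i j : in_shape nu mu i j -> in_shape lam mu i j.
  by move=> /andP[h1 h2]; rewrite /in_shape h1 (leq_trans h2).
have inn i j : in_shape nu mu i j -> glue K nu t i j = t i j.
  by rewrite /glue => /andP[_ ->].
split=> -[h1 h2 h3]; split.
- move=> i j /andP[mj _]; rewrite /glue; case: ifP => // jn.
  by rewrite h1 // /in_shape mj.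
- move=> i j k /andP[mj _] /andP[mk _] jk; rewrite /glue.
  case: (ltnP k (pt nu i)) => kn.
    have jn := ltn_trans jk kn; rewrite jn h2 // /in_shape ?mj ?jn //.
    by rewrite mk kn.
  case: ifP => // jn; rewrite leqW // tK // /in_shape mj jn //.
- move=> i k j /andP[mj _] /andP[mk _] ik; rewrite /glue.
  case: (ltnP j (pt nu k)) => jn.
    have jn' : (j < pt nu i)%N by apply: leq_trans jn (pt_anti _ (ltnW ik)).
    by rewrite jn' h3 // /in_shape ?mj ?jn' // mk jn.
  by case: ifP => // jn'; rewrite leqW // tK // /in_shape mj jn'.
- by move=> i j s; rewrite -inn // h1 // sub.
- by move=> i j k s s' jk; rewrite -!inn // h2 // sub.
by move=> i k j s s' ik; rewrite -!inn // h3 // sub.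
Qed.

(** Restriction to nu/mu and gluing with K+1 are inverse bijections, and [wt_shape_glue] factors the
    weight. *)
Lemma gsum_fixed_split K lam mu nu : subpart mu nu -> subpart nu lam ->
  \sum_(T : bfill K.+1 lam mu | `[< rpp lam mu (bext T) >] &&
      `[< splits K lam mu nu (bext T) >]) wt_shape lam mu (bext T) =
  gone alpha beta (X K.+1) lam nu * gsum K nu mu.
Proof.
move=> mn nl; have /subpartP mn' := mn; have /subpartP nl' := nl.
pose h (T : bfill K nu mu) := brestr K.+1 lam mu (glue K nu (bext T)).
pose h' (T : bfill K.+1 lam mu) := brestr K nu mu (bext T).
have gl (T : bfill K nu mu) i j : in_shape lam mu i j ->
    (glue K nu (bext T) i j <= K.+1)%N.
  move=> /andP[mj _]; rewrite /glue; case: ifP => // jn.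
  by rewrite leqW // bext_le // /in_shape mj.
have hE (T : bfill K nu mu) i j : in_shape lam mu i j ->
    bext (h T) i j = glue K nu (bext T) i j.
  by move=> s; rewrite bext_restr // gl.
have sub i j : in_shape nu mu i j -> in_shape lam mu i j.
  by move=> /andP[h1 h2]; rewrite /in_shape h1 (leq_trans h2).
rewrite /gsum mn big_distrr /= (reindex_onto h h') => [|T /andP[_ /asboolP sp]].
  apply: eq_big => [T|T _]; last first.
    by apply: wt_shape_glue => // i j; [exact: hE|exact: bext_le].
  have -> : h' (h T) == T.
    apply/eqP/bfill_eqP => i j s; rewrite bext_restr ?hE ?sub //.
      by rewrite /glue; case/andP: s => _ ->.
    by rewrite /glue; case/andP: (s) => _ ->; exact: bext_le.
  have -> : `[< splits K lam mu nu (bext (h T)) >].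
    apply/asboolP=> i j s; rewrite hE // /glue; case: ltnP => jn; last by rewrite ltnn.
    by rewrite bext_le // /in_shape jn; case/andP: s => ->.
  rewrite !andbT; apply/asboolP/asboolP => r.
    apply/(@rpp_glue K lam mu nu) => //; first by move=> i j; exact: bext_le.
    by apply: eq_rpp r => i j; exact: hE.
  apply: (@eq_rpp _ _ _ (glue K nu (bext T))) => [i j s|]; first by rewrite hE.
  by apply/(@rpp_glue K lam mu nu) => // i j; exact: bext_le.
apply: bfill_eqP => i j s; rewrite hE // /glue.
case: ifP => jn.
  have s' : in_shape nu mu i j by rewrite /in_shape jn andbT; case/andP: s.
  by rewrite bext_restr // sp.
have := sp _ _ s; rewrite jn => /negbT; rewrite -ltnNge => Kt.
by apply/eqP; rewrite eqn_leq Kt bext_le.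
Qed.

Variable b : nat.
Local Notation bp := (boxpart b n).

Lemma gsum_rec K lam mu : (forall i, pt lam i <= b)%N ->
  gsum K.+1 lam mu =
  \sum_(k : bp) gone alpha beta (X K.+1) lam (bpart k) * gsum K (bpart k) mu.
Proof.
move=> lamb; rewrite {1}/gsum; case: ifPn => [ml|nml]; last first.
  rewrite big1 // => k _; rewrite /gone /gsum.
  case: ifP => kl; last by rewrite mul0r.
  case: ifP => mk; last by rewrite mulr0.
  by rewrite (subpart_trans mk kl) in nml.
pose C (T : bfill K.+1 lam mu) (k : bp) := [&& subpart mu (bpart k),
  subpart (bpart k) lam & `[< splits K lam mu (bpart k) (bext T) >]].
(* Exactly one shape in the box splits a given filling, so the inner sum has one term. *)
transitivity (\sum_(T : bfill K.+1 lam mu | `[< rpp lam mu (bext T) >])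
    \sum_(k | C T k) wt_shape lam mu (bext T)).
  apply: eq_bigr => T /asboolP /(splits_exists K ml)[nu [mn nl sp]].
  have /subpartP nl' := nl.
  have [k ek] : exists k : bp, bpart k = nu.
    by apply: bpart_surj => i; apply: leq_trans (lamb i).
  rewrite (big_pred1 k) // => k' /=; apply/and3P/eqP => [[mk kl /asboolP sp']|->].
    by apply: (@bpart_inj b n); rewrite ek; apply: splits_inj sp' sp.
  by rewrite ek; split=> //; apply/asboolP.
rewrite (exchange_big_dep xpredT) //=; apply: eq_bigr => k _.
have [mk|nmk] := boolP (subpart mu (bpart k)); last first.
  rewrite /gsum (negbTE nmk) mulr0 big1 // => T.
  by rewrite /C (negbTE nmk) andbF.
have [kl|nkl] := boolP (subpart (bpart k) lam); last first.
  rewrite /gone (negbTE nkl) mul0r big1 // => T.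
  by rewrite /C (negbTE nkl) !andbF.
rewrite -gsum_fixed_split //; apply: eq_bigl => T.
by rewrite /C mk kl.
Qed.

Lemma gsum0 lam mu : gsum 0 lam mu = (lam == mu)%:R.
Proof.
rewrite /gsum; case: ifPn => [ml|nml]; last first.
  by case: eqP nml => // ->; rewrite subpart_refl.
have [<-|ne] := eqVneq lam mu.
  have no i j : in_shape lam lam i j = false.
    by apply/negbTE/negP => /andP[h1 /(leq_ltn_trans h1)]; rewrite ltnn.
  rewrite (big_pred1 (brestr 0 lam lam (fun _ _ => 0%N))) => [|T /=].
    by rewrite /wt_shape big1 // => i _; rewrite big_geq.
  have -> : T == brestr 0 lam lam (fun _ _ => 0%N).
    by apply/eqP/bfill_eqP => i j; rewrite no.
  by apply/asboolP; split=> [i j|i j k|i k j]; rewrite no.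
rewrite big1 // => T /asboolP[pos _ _].
case/negP: ne; apply/eqP/subpart_anti => //; apply/subpartP => i.
rewrite leqNgt; apply/negP => lt.
have s : in_shape lam mu i (pt mu i) by rewrite /in_shape leqnn.
by have := pos _ _ s; rewrite lt0n -leqn0 bext_le.
Qed.

Fixpoint xlist K : seq R := if K is K'.+1 then X K'.+1 :: xlist K' else [::].

Lemma gsum_gpath K lam mu : (forall i, pt lam i <= b)%N ->
  gsum K lam mu = gpath b alpha beta (xlist K) lam mu.
Proof.
elim: K lam => [|K IH] lam lamb; first exact: gsum0.
rewrite gsum_rec //=; apply: eq_bigr => k _; rewrite IH // => i.
exact: bpart_le.
Qed.
End Branching.

(** * Coefficient extraction *)

Section Naturality.
Variables (R S : comNzRingType) (phi : {rmorphism R -> S}) (alpha beta : nat -> R).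

Lemma map_ps_mul (f g : nat -> R) :
  phi \o ps_mul f g = ps_mul (phi \o f) (phi \o g).
Proof.
apply/funext=> k; rewrite /= /ps_mul rmorph_sum.
by apply: eq_bigr => i _; rewrite rmorphM.
Qed.

Lemma map_ps_one : phi \o @ps_one R = @ps_one S.
Proof. by apply/funext=> k; rewrite /= /ps_one rmorph_nat. Qed.

Lemma map_hgen Z : phi \o hgen alpha beta Z = hgen (phi \o alpha) (phi \o beta) Z.
Proof.
rewrite /hgen (big_morph (fun f => phi \o f) map_ps_mul map_ps_one).
apply: eq_bigr => u _.
have -> : Defs.pval (phi \o alpha) (phi \o beta) u = phi (Defs.pval alpha beta u).
  by case: u.
set x := Defs.pval alpha beta u.
have geomE : phi \o ps_geom x = ps_geom (phi x).
  by apply/funext=> k; rewrite /= /ps_geom rmorphXn.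
have linE : phi \o ps_lin x = ps_lin (phi x).
  apply/funext=> k; rewrite /= /ps_lin !coefE rmorphB rmorphM /=.
  by rewrite !rmorph_nat.
elim/int_rect: (Z@_u) => [|k E|k E]; first exact: map_ps_one.
  by rewrite -addn1 PoszD !ps_linXS map_ps_mul geomE E.
by rewrite -addn1 PoszD opprD !ps_linXB map_ps_mul linE E.
Qed.

Lemma map_hpl (k : int) Z :
  phi (hpl alpha beta k Z) = hpl (phi \o alpha) (phi \o beta) k Z.
Proof. by rewrite /hpl; case: k => [k|k]; rewrite ?rmorph0 // -map_hgen. Qed.

(** Branching takes place in the ring of polynomials in the x_k, with the parameters as constants.
    Naturality shows that the determinants there are constants too. *)
Lemma map_cdet n (lam nu : intpart n) :
  phi (cdet alpha beta lam nu) = cdet (phi \o alpha) (phi \o beta) lam nu.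
Proof.
rewrite /cdet -det_map_mx; congr (\det _).
by apply/matrixP=> i j; rewrite !mxE map_hpl.
Qed.

Lemma map_cdet' n (lam nu : intpart n) :
  phi (cdet' alpha beta lam nu) = cdet' (phi \o alpha) (phi \o beta) lam nu.
Proof.
rewrite /cdet' -det_map_mx; congr (\det _).
by apply/matrixP=> i j; rewrite !mxE map_hpl.
Qed.
End Naturality.

Section Vanishing.
Variables (R : comNzRingType) (alpha beta : nat -> R) (n : nat).
Implicit Types lam mu : intpart n.

(** A row with mu_k > lam_k makes all indices negative in a corner through (k, k). Leaving [F]
    abstract covers [cdet] and [cdet'] at once. *)
Lemma det_jt_eq0 lam mu (F : 'I_n -> 'I_n -> int -> R) :
  (forall i j (k : int), (k < 0)%R -> F i j k = 0) -> ~~ subpart mu lam ->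
  \det (\matrix_(i, j) F i j ((lam i)%:Z - (mu j)%:Z - i%:Z + j%:Z)) = 0.
Proof.
move=> F0; rewrite /subpart negb_forall => /existsP[k]; rewrite -ltnNge !partE => lk.
apply: (det_zero_corner (k := k)) => i j ki jk; rewrite mxE F0 //.
rewrite !partE; have := pt_anti lam ki; have := pt_anti mu jk; lia.
Qed.

Lemma cdet_eq0 lam mu : ~~ subpart mu lam -> cdet alpha beta lam mu = 0.
Proof.
by apply: (det_jt_eq0 (F := fun i j k => hpl alpha beta k _)) => i j; case.
Qed.

Lemma cdet'_eq0 lam mu : ~~ subpart mu lam -> cdet' alpha beta lam mu = 0.
Proof.
by apply: (det_jt_eq0 (F := fun i j k => hpl alpha beta k _)) => i j; case.
Qed.
End Vanishing.

(** Replaces a finitely supported sum over an infinite type by a finite one, given that the terms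
    outside the image of [h] vanish. *)
Lemma fsbig_inj_image (V : nmodType) (I : finType) (J : choiceType) (h : I -> J)
    (P : pred I) (A : set J) (F : J -> V) :
  injective h -> (forall i, P i <-> A (h i)) ->
  (forall j, A j -> (forall i, j <> h i) -> F j = 0) ->
  \sum_(j \in A) F j = \sum_(i | P i) F (h i).
Proof.
move=> hi PA F0; rewrite (fsbigE [seq h i | i <- enum P]).
- rewrite big_map big_enum_cond; apply: eq_bigl => i.
  by rewrite andb_idr // => Pi; apply: mem_set; exact/PA.
- by rewrite map_inj_uniq ?enum_uniq.
- by move=> j /= /mapP[i]; rewrite mem_enum => Pi ->; apply/PA.
move=> j Aj jr; apply: F0 => // i ji; case/negP: jr; apply/mapP; exists i => //.
by rewrite mem_enum; apply/PA; rewrite -ji.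
Qed.

(** * Tableau sums as coefficients of finite sums *)

Section Tableaux.
Variables (R : comNzRingType) (n : nat).
Local Notation A := {malg R[{cmonom nat}]}.
Implicit Types (lam mu : intpart n) (m : {cmonom nat}).

Lemma mcoeff_xvarM v (p : A) m : m v = 0%N -> (xvar R v * p)@_m = 0.
Proof.
move=> mv; apply/eqP; rewrite mcoeff_eq0; apply/negP => /msuppM_le[k1 [k2 []]].
rewrite msuppU1 in_fset1 => /eqP -> _ e.
by have := mv; rewrite e cmM ucmE eqxx.
Qed.

Lemma fill_of_inj K lam mu : injective (@fill_of n K lam mu).
Proof.
move=> T U e; apply/ffunP=> c; apply: val_inj => /=.
by move/ffunP: e => /(_ c); rewrite !ffunE.
Qed.

Lemma fill_of_surj K lam mu (T : filling lam mu) :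
  (forall c, T c <= K)%N -> exists U : bfill K lam mu, T = fill_of U.
Proof.
move=> TK; exists [ffun c => inord (T c)]; apply/ffunP=> c.
by rewrite !ffunE /= inordK // ltnS.
Qed.

(* Among the cells with entry v, moving right or up decreases the minimized *)
(* quantity, so the minimizing cell is neither marked nor of weight beta.    *)
Lemma wt_large (alpha beta : nat -> R) lam mu (T : marked lam mu) m c :
  is_mrpp T -> m (T.1 c) = 0%N -> (wt alpha beta T)@_m = 0.
Proof.
move=> /andP[_ /forallP mk] mv; set v := T.1 c in mv.
have cv : T.1 c == v by [].
pose M := (\max_i lam i)%N.
case: (@arg_minnP _ c (fun d => T.1 d == v)
  (fun d => row_of d + (M - col_of d))%N cv) => d /eqP dv dmin.
have colM (e : cell lam mu) : (col_of e < M)%N by exact: ltn_ord.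
rewrite /wt (bigD1 d) //= /wcell.
have /negbTE -> : d \notin T.2.
  apply/negP => dT; have := mk d; rewrite dT /= => /existsP[e /andP[/andP[]]].
  rewrite /crow /ccol eqSS => /eqP r /eqP k /eqP de.
  have := dmin e; rewrite -de dv eqxx => /(_ isT).
  have re : row_of e = row_of d by []; have ke : col_of e = (col_of d).+1 by case: k.
  have := colM e; rewrite re ke; lia.
case: existsP => [[e /andP[/andP[]]]|_]; last by rewrite dv; exact: mcoeff_xvarM.
rewrite /crow /ccol eqSS => /eqP r /eqP k /eqP de.
have := dmin e; rewrite de dv eqxx => /(_ isT).
have re : (row_of e).+1 = row_of d by [].
have ke : col_of e = col_of d by case: k.
rewrite -re ke; lia.
Qed.

(** Distributivity: expanding the product of (marked + unmarked) over the cells gives a sum over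
    sets of marked cells, in which the forbidden sets contain a zero factor. *)
Lemma sum_marks (alpha beta : nat -> R) lam mu (T : filling lam mu) :
  \sum_(S : {set cell lam mu} | [forall c in S, [exists d, is_right c d && (T c == T d)]])
    wt alpha beta (T, S) =
  wt_shape (fun k => (alpha k)%:MP) (fun k => (beta k)%:MP) (@xvar R) lam mu (extend T).
Proof.
rewrite /wt_shape -prod_cell.
pose F (c : cell lam mu) : A :=
  if [exists d, is_right c d && (T c == T d)] then (- alpha (ccol c))%:MP else 0.
pose G (c : cell lam mu) : A :=
  if [exists d, is_above c d && (T d == T c)] then (beta (crow c).-1)%:MP
  else xvar R (T c).
rewrite (eq_bigr (fun c => F c + G c)) => [|c _]; last first.
  rewrite /wt_at /F /G right_exists above_exists extendE /crow /ccol /=.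
  by rewrite raddfN.
rewrite bigA_distr big_mkcond /=; apply: eq_bigr => S _.
case: ifPn => [/forallP h|].
  rewrite /wt; apply: eq_bigr => c _; rewrite /wcell /F /G /=.
  by case: ifP => // cS; have := h c; rewrite cS /= => ->.
rewrite negb_forall => /existsP[c]; rewrite negb_imply => /andP[cS /negbTE h].
by rewrite (bigD1 c) //= cS /F h mul0r.
Qed.

Lemma gskew_gsum (alpha beta : nat -> R) lam mu m K :
  (forall v, (K < v)%N -> m v = 0%N) ->
  gskew alpha beta lam mu m =
  (gsum (fun k => (alpha k)%:MP) (fun k => (beta k)%:MP) (@xvar R) K lam mu)@_m.
Proof.
move=> mK; rewrite /gskew /gsum; case: ifP => _; last by rewrite mcoeff0.
pose h (p : bfill K lam mu * {set cell lam mu}) : marked lam mu := (fill_of p.1, p.2).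
rewrite (@fsbig_inj_image _ _ _ h (fun p => is_mrpp (h p))) //; first last.
- move=> [T S] /= mT nT; have [/forallP TK|] := boolP [forall c, (T c <= K)%N].
    by have [U eU] := fill_of_surj TK; case: (nT (U, S)); rewrite /h eU.
  rewrite negb_forall => /existsP[c]; rewrite -ltnNge => /mK mc.
  exact: wt_large mT mc.
- by move=> [T S] [U S'] [/fill_of_inj -> ->].
rewrite -raddf_sum; congr (_ @_m).
rewrite -(pair_big_dep (fun T : bfill K lam mu => is_rpp (fill_of T))
  (fun T (S : {set cell lam mu}) =>
     [forall c in S, [exists d, is_right c d && (fill_of T c == fill_of T d)]])
  (fun T S => wt alpha beta (fill_of T, S))) /=.
apply: eq_big => [T|T _]; last exact: sum_marks.
by apply/is_rppP/asboolP.
Qed.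

(** A skew shape contains every cell between two cells of a column, so strictness need only be
    tested on vertical neighbours. *)
Lemma is_ssytE lam mu (T : filling lam mu) : is_ssyt T =
  is_rpp T && [forall c, ~~ [exists d, is_above c d && (T d == T c)]].
Proof.
apply/and3P/andP => [[p r /forallP s]|[/and3P[p r /forallP w] /forallP a]].
  split; first (apply/and3P; split=> //).
    apply/forallP=> c; apply/forallP=> d; apply/implyP=> h.
    by apply: ltnW; move/forallP/(_ d)/implyP: (s c); apply.
  apply/forallP=> c; rewrite negb_exists; apply/forallP=> d.
  apply/negP=> /andP[/andP[/eqP e1 e2] /eqP e].
  move/forallP/(_ c)/implyP: (s d); rewrite e2 -e1 ltnSn => /(_ isT).
  by rewrite e ltnn.
split=> //; apply/forallP=> c; apply/forallP=> d; apply/implyP=> /andP[/eqP k r'].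
have rcd : (row_of c < row_of d)%N by [].
have kcd : col_of c = col_of d by case: k.
have /in_shapeP[e re ke] : in_shape lam mu (row_of d).-1 (col_of d).
  have /andP[_ h2] := cell_in_shape d; have /andP[h1 _] := cell_in_shape c.
  rewrite /in_shape (leq_trans h2) ?pt_anti ?leq_pred // andbT -kcd.
  by apply: leq_trans h1; apply: pt_anti; rewrite -ltnS prednK // (leq_ltn_trans _ rcd).
have re' : (row_of e).+1 = row_of d by rewrite re prednK // (leq_ltn_trans _ rcd).
have ed : (T e < T d)%N.
  rewrite ltn_neqAle; apply/andP; split.
    have := a d; rewrite negb_exists => /forallP/(_ e).
    rewrite /is_above /crow /ccol -[nat_of_ord (val e).1]/(row_of e).
    rewrite -[nat_of_ord (val e).2]/(col_of e) re' ke !eqxx /=.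
    by [].
  have lt : (row_of e < row_of d)%N by rewrite -re'.
  move/forallP/(_ d)/implyP: (w e); apply; rewrite /crow /ccol !eqSS !ltnS.
  by apply/andP; split; [exact/eqP|exact: lt].
apply: leq_ltn_trans ed.
case: (ltngtP (row_of c) (row_of e)) => rce.
- move/forallP/(_ e)/implyP: (w c); apply; rewrite /crow /ccol !eqSS !ltnS.
  by apply/andP; split=> //; apply/eqP; rewrite -[LHS]/(col_of c) kcd -ke.
- by move: rcd; rewrite -re' ltnS leqNgt rce.
by rewrite (@cell_eqP _ _ _ c e) // kcd.
Qed.

(** With zero parameters a cell equal to the one above it has weight 0, so only semistandard
    fillings survive, with their usual monomials. *)
Lemma sskew_gsum lam mu m K : (forall v, (K < v)%N -> m v = 0%N) ->
  sskew R lam mu m =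
  (gsum (fun=> 0 : A) (fun=> 0) (@xvar R) K lam mu)@_m.
Proof.
move=> mK; rewrite /sskew /gsum; case: ifP => _; last by rewrite mcoeff0.
rewrite (@fsbig_inj_image _ _ _ (@fill_of n K lam mu)
  (fun T => is_ssyt (fill_of T))) //; first last.
- move=> T /= sT nT; have [/forallP TK|] := boolP [forall c, (T c <= K)%N].
    by have [U eU] := fill_of_surj TK; case: (nT U).
  rewrite negb_forall => /existsP[c]; rewrite -ltnNge => /mK mc.
  by rewrite (bigD1 c) //= mcoeff_xvarM.
- exact: fill_of_inj.
rewrite -raddf_sum; congr (_ @_m).
rewrite (eq_bigl _ _ (fun T => is_ssytE (fill_of T))) big_mkcondr.
apply: eq_big => [T|T _]; first by apply/is_rppP/asboolP.
rewrite /wt_shape -prod_cell.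
have wE (c : cell lam mu) : wt_at (fun=> 0) (fun=> 0) (@xvar R) lam mu (bext T)
    (row_of c) (col_of c) =
    if [exists d, is_above c d && (fill_of T d == fill_of T c)] then 0
    else xvar R (fill_of T c).
  by rewrite /wt_at oppr0 if_same add0r above_exists /bext extendE.
rewrite (eq_bigr _ (fun c _ => wE c)).
case: ifPn => [/forallP h|].
  by apply: eq_bigr => c _; rewrite (negbTE (h c)).
rewrite negb_forall => /existsP[c]; rewrite negbK => h.
by rewrite (bigD1 c) //= h mul0r.
Qed.
End Tableaux.

(** * The identity for the coefficient of a fixed monomial *)

Lemma cmonom_bound (m : {cmonom nat}) :
  exists K, forall v, (K < v)%N -> m v = 0%N.
Proof.
exists (\max_(v <- finsupp m) v)%N => v lt; apply: fsfun_dflt; apply/negP => vm.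
by move: lt; rewrite ltnNge (leq_bigmax_seq (F := fun v => v)).
Qed.

Theorem theorem8p7 (R : comNzRingType) (alpha beta : nat -> R)
    (n : nat) (lam mu : intpart n) (m : {cmonom nat}) :
  gskew alpha beta lam mu m =
    \sum_(p \in [set p : intpart n * intpart n |
                  [/\ subpart mu p.1, subpart p.1 p.2 & subpart p.2 lam]]%classic)
      cdet alpha beta lam p.2 * sskew R p.2 p.1 m * cdet' alpha beta p.1 mu.
Proof.
have [ml|nml] := boolP (subpart mu lam); last first.
  rewrite fsbig1; first by rewrite /gskew (negbTE nml).
  by move=> p /= [h1 h2 h3]; rewrite (subpart_trans h1 (subpart_trans h2 h3)) in nml.
(* The largest part of [lam] bounds all the partitions between [mu] and [lam]. *)
pose b := pt lam 0.
have lamb i : (pt lam i <= b)%N by exact: pt_anti.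
have [f ef] : exists f : boxpart b n, bpart f = lam by exact: bpart_surj.
have [g eg] : exists g : boxpart b n, bpart g = mu.
  by apply: bpart_surj => i; move/subpartP: ml => /(_ i) /leq_trans; apply.
have [K mK] := cmonom_bound m.
rewrite (gskew_gsum _ _ _ _ mK) (gsum_gpath _ _ _ _ _ lamb) -ef -eg gpath_factor.
pose h (q : boxpart b n * boxpart b n) := (bpart q.1, bpart q.2).
rewrite (@fsbig_inj_image _ _ _ h (fun q => [&& subpart mu (bpart q.1),
  subpart (bpart q.1) (bpart q.2) & subpart (bpart q.2) lam])); first last.
- move=> [rho nu] /= [h1 h2 h3] nh; rewrite ef in h3.
  have [nu' enu] : exists k : boxpart b n, bpart k = nu.
    by apply: bpart_surj => i; apply: leq_trans (lamb i); exact/subpartP.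
  have [rho' erho] : exists k : boxpart b n, bpart k = rho.
    apply: bpart_surj => i; apply: leq_trans (lamb i); apply/subpartP.
    exact: subpart_trans h2 h3.
  by case: (nh (rho', nu')); rewrite /h /= enu erho.
- by move=> q; rewrite ef eg; split=> [/and3P|] []// h1 h2 h3; apply/and3P.
- move=> [a1 a2] [c1 c2] e; congr pair; apply: bpart_inj.
    by have := congr1 (fun p => p.1) e.
  by have := congr1 (fun p => p.2) e.
(* The box also contains pairs violating the inclusions; each violated inclusion makes one of the
   three factors vanish. *)
rewrite [RHS]big_mkcond exchange_big pair_big raddf_sum; apply: eq_bigr => -[rho nu] _ /=.
pose phi : {rmorphism R -> {malg R[{cmonom nat}]}} :=
  GRing.RMorphism.clone _ _ (@malgC {cmonom nat} R) _.
rewrite -(map_cdet phi) -(map_cdet' phi) -mulrA mcoeffCM mulrC [_ * phi _]mulrC mcoeffCM.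
rewrite -(gsum_gpath _ _ _ _ _ (bpart_le nu)) -(sskew_gsum _ _ _ mK).
case: ifPn => [_|]; first by ring.
rewrite -ef -eg !negb_and => /or3P[] nsub.
- by rewrite cdet'_eq0 // !mul0r.
- by rewrite /sskew (negbTE nsub) mulr0 mul0r.
by rewrite cdet_eq0 // mulr0.
Qed.
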